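(* Let $n$ be a positive even integer and let $a_0,\dots,a_4,b_0,b_1,b_2\in\mathbb{C}$. With the notation of the context, the formula $$\{\phi,\psi\}=n\lambda_{ev}(\phi_1\psi_2-\psi_1\phi_2)+\phi_1D(\psi_2)+\phi_2D(\psi_1)-\psi_1D(\phi_2)-\psi_2D(\phi_1),\qquad \phi,\psi\in\mathcal{F}_n,$$ has values $\{\phi,\psi\}\in S^2\mathcal{F}_n$ and defines a quadratic Poisson bracket on the polynomial ring $S^*\mathcal{F}_n=\mathbb{C}[x_0,x_2,x_3,\dots,x_n]$. This Poisson bracket is linear (non-homogeneous) with respect to the coefficients $a_0,\dots,a_4,b_0,b_1,b_2$ and therefore can be written in the form $$\{\cdot,\cdot\}=\{\cdot,\cdot\}_0+\sum_{i=0}^4a_i\{\cdot,\cdot\}_{i,1}+\sum_{j=0}^2b_j\{\cdot,\cdot\}_{j,2},$$ where the nine brackets $\{\cdot,\cdot\}_0$, $\{\cdot,\cdot\}_{i,1}$ ($0\le i\le 4$), $\{\cdot,\cdot\}_{j,2}$ ($0\le j\le 2$) on $\mathbb{C}[x_0,x_2,x_3,\dots,x_n]$ do not depend on $a_0,\dots,a_4,b_0,b_1,b_2$ and are pairwise compatible quadratic Poisson brackets.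
   Context: Let $P_{ev}(t)=a_0+a_1t+a_2t^2+a_3t^3+a_4t^4$ and $Q(t)=b_0+b_1t+b_2t^2$. Let $\mathcal{F}=\mathcal{F}_{ev}$ be the commutative associative unital $\mathbb{C}$-algebra generated by $f,g$ with the single relation $g^2=P_{ev}(f)+Q(f)g$. Let $D$ be the derivation of $\mathcal{F}$ with $D(f)=2g-Q(f)$, $D(g)=P_{ev}'(f)+Q'(f)g$. For $h\in\mathcal{F}$ write $h_1=h\otimes1$, $h_2=1\otimes h$ in $\mathcal{F}\otimes\mathcal{F}$ (tensor product over $\mathbb{C}$), and $D(h_1)=D(h)\otimes 1$, $D(h_2)=1\otimes D(h)$. Let $\mathrm{Frac}(\mathcal{F}\otimes\mathcal{F})$ be the total ring of fractions (the field of fractions when $\mathcal{F}\otimes\mathcal{F}$ is a domain); $f_1-f_2$ is not a zero divisor. The element $\lambda_{ev}\in\mathrm{Frac}(\mathcal{F}\otimes\mathcal{F})$ is defined by $$(f_1-f_2)\lambda_{ev}=g_1+g_2-\tfrac12Q(f_1)-\tfrac12Q(f_2).$$ Put $x_{2i}=f^i$, $x_{2i+3}=f^ig$ for $i=0,1,2,\dots$ (so $x_0,x_2,x_3,x_4,\dots$ are defined and there is no $x_1$). $\mathcal{F}_n\subset\mathcal{F}$ is the $n$-dimensional linear subspace with basis $\{x_0\}\cup\{x_i: 2\le i\le n\}$. The symmetric algebra $S^*\mathcal{F}_n$ is identified with the polynomial algebra $\mathbb{C}[x_0,x_2,x_3,\dots,x_n]$. The space $S^2\mathcal{F}_n$ is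 identified with the symmetric tensors in $\mathcal{F}_n\otimes\mathcal{F}_n\subset\mathcal{F}\otimes\mathcal{F}$ so that the product $\phi\psi$ corresponds to $\phi_1\psi_2+\psi_1\phi_2$. In particular $f_1^if_2^j+f_1^jf_2^i=x_{2i}x_{2j}$, $f_1^if_2^jg_2+f_1^jf_2^ig_1=x_{2i}x_{2j+3}$, $(f_1^if_2^j+f_1^jf_2^i)g_1g_2=x_{2i+3}x_{2j+3}$. The bracket given on $\mathcal{F}_n$ is extended to $S^*\mathcal{F}_n$ by bilinearity and the Leibniz rule. A Poisson bracket on a polynomial ring is quadratic if the bracket of any two generators is a homogeneous quadratic polynomial (possibly zero). Two Poisson brackets $\{\cdot,\cdot\}$ and $\{\cdot,\cdot\}'$ are compatible if $\{\cdot,\cdot\}+u\{\cdot,\cdot\}'$ is a Poisson bracket for every constant $u\in\mathbb{C}$. *)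

(* Defs.v *)
From HB Require Import structures.
From mathcomp Require Import all_boot all_order all_algebra generic_quotient.
From mathcomp Require Import boolp reals.
From mathcomp Require Import complex mpoly ring.

Set Implicit Arguments.
Unset Strict Implicit.
Unset Printing Implicit Defensive.

Import GRing.Theory.
Local Open Scope ring_scope.
Local Open Scope quotient_scope.

(* Total ring of fractions of a commutative ring: like FracField.type of      *)
(* fraction.v, with regular elements instead of nonzero elements of a domain. *)

Module TotalFrac.
Section TotalFrac.

Variable A : comNzRingType.

Definition regular (a : A) : bool := asbool (GRing.lreg a).

Lemma regularP a : reflect (GRing.lreg a) (regular a).
Proof. exact: asboolP. Qed.

Lemma regular1 : regular 1.
Proof. by apply/regularP; exact: lreg1. Qed.

Lemma regularM a b : regular a -> regular b -> regular (a * b).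
Proof. by move=> /regularP ra /regularP rb; apply/regularP/lregM. Qed.

Inductive ratio := MkRatio { pair_of :> A * A; _ : regular pair_of.2 }.

HB.instance Definition _ := [isSub for pair_of].
HB.instance Definition _ := [Choice of ratio by <:].

Lemma denP (x : ratio) : regular x.2. Proof. by case: x. Qed.
Hint Resolve denP regular1 : core.

Definition Ratio (a s : A) : ratio :=
  insubd (MkRatio (pair_of := (0, 1)) regular1) (a, s).

Lemma num_Ratio a s : regular s -> (Ratio a s).1 = a.
Proof. by move=> rs; rewrite /Ratio /insubd insubT. Qed.

Lemma den_Ratio a s : regular s -> (Ratio a s).2 = s.
Proof. by move=> rs; rewrite /Ratio /insubd insubT. Qed.

Definition numden := (num_Ratio, den_Ratio).

Lemma Ratio_numden (x : ratio) : Ratio x.1 x.2 = x.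
Proof.
by apply: val_inj; rewrite /Ratio val_insubd; case: x => -[a s] /= ->.
Qed.

Definition equivf (x y : ratio) := x.1 * y.2 == x.2 * y.1.

Lemma equivf_refl : reflexive equivf.
Proof. by move=> x; rewrite /equivf mulrC. Qed.

Lemma equivf_sym : ssrbool.symmetric equivf.
Proof. by move=> x y; rewrite /equivf eq_sym; congr (_ == _); rewrite mulrC. Qed.

Lemma equivf_trans : transitive equivf.
Proof.
move=> y x z; rewrite /equivf => /eqP xy /eqP yz; apply/eqP.
have /regularP ry := denP y; apply: ry.
by rewrite mulrA [y.2 * _]mulrC xy -mulrA yz mulrCA.
Qed.

Canonical equivf_equiv := EquivRel equivf equivf_refl equivf_sym equivf_trans.

Definition type := {eq_quot equivf}.

HB.instance Definition _ : EqQuotient _ equivf type := EqQuotient.on type.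
HB.instance Definition _ := Choice.on type.

Lemma equivf_def (x y : ratio) :
  x == y %[mod type] = (x.1 * y.2 == x.2 * y.1).
Proof. by rewrite eqmodE. Qed.

Lemma equivf_r (x : ratio) :
  x.1 * (repr (\pi_type x)).2 = x.2 * (repr (\pi_type x)).1.
Proof. by apply/eqP; rewrite -equivf_def reprK. Qed.

Lemma equivf_l (x : ratio) :
  (repr (\pi_type x)).1 * x.2 = (repr (\pi_type x)).2 * x.1.
Proof. by apply/eqP; rewrite -equivf_def reprK. Qed.

Definition tofrac := lift_embed type (fun a : A => Ratio a 1).
Canonical tofrac_pi_morph := PiEmbed tofrac.

Definition addf (x y : ratio) := Ratio (x.1 * y.2 + y.1 * x.2) (x.2 * y.2).
Definition add := lift_op2 type addf.

Lemma pi_add : {morph \pi : x y / addf x y >-> add x y}.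
Proof.
move=> x y; unlock add; apply/eqmodP; rewrite /= /equivf /addf /=.
rewrite !numden ?regularM // mulrDr mulrDl; apply/eqP; symmetry.
rewrite (AC (2*2) (3*1*2*4)) (AC (2*2) (3*2*1*4))/=.
by rewrite !equivf_l (ACl ((2*3)*(1*4))) (ACl ((2*3)*(4*1)))/=.
Qed.
Canonical pi_add_morph := PiMorph2 pi_add.

Definition oppf (x : ratio) := Ratio (- x.1) x.2.
Definition opp := lift_op1 type oppf.

Lemma pi_opp : {morph \pi : x / oppf x >-> opp x}.
Proof.
move=> x; unlock opp; apply/eqmodP; rewrite /= /equivf /oppf /=.
by rewrite !numden // mulNr mulrN -equivf_r.
Qed.
Canonical pi_opp_morph := PiMorph1 pi_opp.

Definition mulf (x y : ratio) := Ratio (x.1 * y.1) (x.2 * y.2).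
Definition mul := lift_op2 type mulf.

Lemma pi_mul : {morph \pi : x y / mulf x y >-> mul x y}.
Proof.
move=> x y; unlock mul; apply/eqmodP=> /=.
rewrite /equivf /= /mulf /= !numden ?regularM //.
by rewrite mulrACA !equivf_r mulrACA.
Qed.
Canonical pi_mul_morph := PiMorph2 pi_mul.

Lemma addA : associative add.
Proof.
elim/quotW=> x; elim/quotW=> y; elim/quotW=> z; rewrite !piE.
rewrite /addf /= !numden ?regularM // !mulrDl.
by rewrite !mulrA !addrA ![_ * _ * x.2]mulrAC.
Qed.

Lemma addC : commutative add.
Proof.
by elim/quotW=> x; elim/quotW=> y; rewrite !piE /addf addrC [y.2 * _]mulrC.
Qed.

Lemma add0_l : left_id (tofrac 0) add.
Proof.
elim/quotW=> x; rewrite !piE /addf !numden //.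
by rewrite mul0r mul1r mulr1 add0r Ratio_numden.
Qed.

Lemma addN_l : left_inverse (tofrac 0) opp add.
Proof.
elim/quotW=> x; apply/eqP; rewrite piE /equivf.
rewrite /addf /oppf !numden ?regularM //.
by rewrite mulr1 mulr0 mulNr addNr.
Qed.

HB.instance Definition _ := GRing.isZmodule.Build type addA addC add0_l addN_l.

Lemma mulA : associative mul.
Proof.
elim/quotW=> x; elim/quotW=> y; elim/quotW=> z; rewrite !piE.
by rewrite /mulf !numden ?regularM // !mulrA.
Qed.

Lemma mulC : commutative mul.
Proof.
elim/quotW=> x; elim/quotW=> y; rewrite !piE /mulf.
by rewrite [x.1 * _]mulrC [x.2 * _]mulrC.
Qed.

Lemma mul1_l : left_id (tofrac 1) mul.
Proof.
by elim/quotW=> x; rewrite !piE /mulf !numden // !mul1r Ratio_numden.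
Qed.

Lemma mul_addl : left_distributive mul add.
Proof.
elim/quotW=> x; elim/quotW=> y; elim/quotW=> z; apply/eqP.
rewrite !piE /equivf /mulf /addf !numden ?regularM //; apply/eqP.
rewrite !(mulrDr, mulrDl) (AC (3*(2*2)) (4*2*7*((1*3)*(6*5))))/=.
by rewrite [X in _ + X](AC (3*(2*2)) (4*6*7*((1*3)*(2*5))))/=.
Qed.

Lemma nonzero1 : tofrac 1 != tofrac 0.
Proof. by rewrite piE /equivf !numden // !mul1r oner_eq0. Qed.

HB.instance Definition _ :=
  GRing.Zmodule_isComNzRing.Build type mulA mulC mul1_l mul_addl nonzero1.

Lemma tofrac_is_zmod_morphism : zmod_morphism tofrac.
Proof.
move=> p q /=; unlock tofrac.
rewrite -[X in _ = _ + X]pi_opp -[RHS]pi_add.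
by rewrite /addf /oppf /= !numden // !mul1r !mulr1.
Qed.
HB.instance Definition _ :=
  GRing.isZmodMorphism.Build A type tofrac tofrac_is_zmod_morphism.

Lemma tofrac_is_monoid_morphism : monoid_morphism tofrac.
Proof.
split=> [//|p q]; unlock tofrac; rewrite -[RHS]pi_mul.
by rewrite /mulf /= !numden // !mul1r.
Qed.
HB.instance Definition _ :=
  GRing.isMonoidMorphism.Build A type tofrac tofrac_is_monoid_morphism.

Lemma tofrac_inj : injective tofrac.
Proof.
move=> p q; unlock tofrac => /eqmodP /eqP /=.
by rewrite !numden // mulr1 mul1r.
Qed.

(* The fraction a / s; meaningful only for s regular. *)
Definition fract (a s : A) : type := \pi_type (Ratio a s).

Lemma fractP a s : GRing.lreg s -> tofrac s * fract a s = tofrac a.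
Proof.
move=> /regularP rs; rewrite /fract; unlock tofrac; rewrite -[LHS]pi_mul.
by apply/eqmodP; rewrite /= /equivf /mulf !numden ?regularM // !mul1r mulr1.
Qed.

Lemma fract_surj (x : type) : exists a s, GRing.lreg s /\ x = fract a s.
Proof.
elim/quotW: x => x; exists x.1, x.2; split; first by apply/regularP/denP.
by rewrite /fract Ratio_numden.
Qed.

End TotalFrac.
End TotalFrac.
HB.export TotalFrac.

Notation "{ 'totfrac' A }" := (TotalFrac.type A)
  (at level 0, format "{ 'totfrac'  A }") : type_scope.
Notation tofrac := (@TotalFrac.tofrac _).
Notation fract := (@TotalFrac.fract _).

(* The algebra A[f, g] / (g^2 = P(f) + Q(f) g), as a quotient of A[f][g].     *)

Import Pdiv.CommonRing Pdiv.RingMonic.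

Section Curve.

Variables (A : comNzRingType) (P Q : {poly A}).

Definition curve_rel : {poly {poly A}} := 'X^2 - (Q *: 'X + P%:P).

Definition curve := {poly %/ curve_rel}.

HB.instance Definition _ := GRing.ComNzRing.on curve.

Definition curve_scale (c : A) (h : curve) : curve := c%:P *: h.

Fact curve_scaleA a b h :
  curve_scale a (curve_scale b h) = curve_scale (a * b) h.
Proof. by rewrite /curve_scale scalerA polyCM. Qed.
Fact curve_scale1 : left_id 1 curve_scale.
Proof. by move=> h; rewrite /curve_scale scale1r. Qed.
Fact curve_scaleDr : right_distributive curve_scale +%R.
Proof. by move=> c h k; rewrite /curve_scale scalerDr. Qed.
Fact curve_scaleDl h : {morph curve_scale^~ h : a b / a + b}.
Proof. by move=> a b; rewrite /curve_scale polyCD scalerDl. Qed.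
HB.instance Definition _ := GRing.Zmodule_isLmodule.Build A curve
  curve_scaleA curve_scale1 curve_scaleDr curve_scaleDl.

Fact curve_scaleAl (c : A) (h k : curve) : c *: (h * k) = c *: h * k.
Proof. exact: (@scalerAl _ {poly %/ curve_rel}). Qed.
HB.instance Definition _ := GRing.Lmodule_isLalgebra.Build A curve curve_scaleAl.
Fact curve_scaleAr (c : A) (h k : curve) : c *: (h * k) = h * (c *: k).
Proof. by rewrite mulrC curve_scaleAl mulrC. Qed.
HB.instance Definition _ := GRing.Lalgebra_isAlgebra.Build A curve curve_scaleAr.

Definition curve_pi : {poly {poly A}} -> curve := in_qpoly curve_rel.
HB.instance Definition _ := GRing.RMorphism.on curve_pi.

Definition curve_f : curve := curve_pi 'X%:P.
Definition curve_g : curve := curve_pi 'X.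

Lemma size_curve_rel_tail : (size (Q *: 'X + P%:P : {poly {poly A}})%R < 3)%N.
Proof.
rewrite (leq_ltn_trans (size_polyD _ _)) // gtn_max.
rewrite (leq_ltn_trans (size_scale_leq _ _)) ?size_polyX //.
by rewrite (leq_ltn_trans (size_polyC_leq1 _)).
Qed.

Lemma size_curve_rel : size curve_rel = 3%N.
Proof. by rewrite size_polyDl size_polyXn // size_polyN size_curve_rel_tail. Qed.

Lemma monic_curve_rel : curve_rel \is monic.
Proof.
rewrite monicE lead_coefDl ?lead_coefXn //.
by rewrite size_polyN size_polyXn size_curve_rel_tail.
Qed.

Lemma mk_monic_curve_rel : mk_monic curve_rel = curve_rel.
Proof. by rewrite /mk_monic size_curve_rel monic_curve_rel. Qed.

Lemma curve_valK (h : curve) : curve_pi (val h) = h.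
Proof. by apply: val_inj; rewrite /= rmodp_small // size_mk_monic. Qed.

Lemma size_curve (h : curve) : (size (val h : {poly {poly A}}) <= 2)%N.
Proof.
by have := size_mk_monic h; rewrite {2}mk_monic_curve_rel size_curve_rel ltnS.
Qed.

Lemma curve_pi_val (p : {poly {poly A}}) :
  (size p <= 2)%N -> val (curve_pi p) = p.
Proof.
by move=> sp; rewrite /= rmodp_small // mk_monic_curve_rel size_curve_rel.
Qed.

Lemma curve_piZ (c : A) (p : {poly {poly A}}) :
  curve_pi (c%:P *: p) = c *: curve_pi p.
Proof. exact: (in_qpolyZ curve_rel c%:P p). Qed.

Lemma curve_piC (c : A) : curve_pi c%:P%:P = c%:A.
Proof. by rewrite -alg_polyC curve_piZ rmorph1. Qed.

Lemma curve_pi_rel : curve_pi curve_rel = 0.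
Proof.
by apply: val_inj; rewrite /= mk_monic_curve_rel rmodpp // monic_curve_rel.
Qed.

Lemma horner_cf (p : {poly A}) : horner_alg curve_f p = curve_pi p%:P.
Proof.
elim/poly_ind: p => [|p c IHp]; first by rewrite !rmorph0.
rewrite rmorphD rmorphM /= IHp horner_algC horner_algX -curve_piC.
by rewrite -rmorphM -rmorphD /= -polyCM -polyCD.
Qed.

Lemma curve_relE :
  curve_g ^+ 2 = horner_alg curve_f P + horner_alg curve_f Q * curve_g.
Proof.
have := curve_pi_rel; rewrite /curve_rel rmorphB rmorphXn => /subr0_eq /= ->.
by rewrite rmorphD /= !horner_cf -mul_polyC rmorphM addrC.
Qed.

Lemma curve_relP (p : {poly {poly A}}) :
  curve_pi p = 0 -> exists q, p = q * curve_rel.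
Proof.
move=> /(congr1 val) /=; rewrite mk_monic_curve_rel => p0.
exists (rdivp p curve_rel).
by rewrite [LHS](rdivp_eq monic_curve_rel) p0 addr0.
Qed.

(* Values on a lift of the ring morphism with value u on A, and with f and g  *)
(* sent to s and t; see curve_lift_morph.                                     *)
Section Lift.

Variables (S : comNzRingType) (u : {rmorphism A -> S}) (s t : S).

Definition curve_lift (h : curve) : S :=
  (map_poly (fun p : {poly A} => (map_poly u p).[s]) (val h)).[t].

Let in1 : {rmorphism {poly A} -> S} := horner_morph (fun c => mulrC s (u c)).
Let in2 : {rmorphism {poly {poly A}} -> S} :=
  horner_morph (fun p => mulrC t (in1 p)).

Let in1C c : in1 c%:P = u c. Proof. exact: horner_morphC. Qed.
Let in1X : in1 'X = s. Proof. exact: horner_morphX. Qed.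
Let in2C p : in2 p%:P = in1 p. Proof. exact: horner_morphC. Qed.
Let in2X : in2 'X = t. Proof. exact: horner_morphX. Qed.

Let curve_lift_uniq_pi (w : {rmorphism curve -> S}) :
  (forall c, w c%:A = u c) -> w curve_f = s -> w curve_g = t ->
  forall p, w (curve_pi p) = in2 p.
Proof.
move=> wA wf wg; elim/poly_ind => [|p c IHp]; first by rewrite !rmorph0.
rewrite !rmorphD !rmorphM IHp -/curve_g wg in2X in2C; congr (_ + _).
elim/poly_ind: c {p IHp} => [|p c IHp]; first by rewrite polyC0 !rmorph0.
rewrite polyCD polyCM !rmorphD !rmorphM.
by rewrite IHp -/curve_f wf /= curve_piC wA in1X in1C.
Qed.

Lemma curve_lift_uniq (w w' : {rmorphism curve -> S}) :
  (forall c, w c%:A = u c) -> w curve_f = s -> w curve_g = t ->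
  (forall c, w' c%:A = u c) -> w' curve_f = s -> w' curve_g = t -> w =1 w'.
Proof.
move=> wA wf wg wA' wf' wg' h.
have E := curve_lift_uniq_pi wA wf wg (val h).
have E' := curve_lift_uniq_pi wA' wf' wg' (val h).
by rewrite curve_valK in E E'; rewrite E E'.
Qed.

Hypothesis st_rel :
  t ^+ 2 = (map_poly u P).[s] + (map_poly u Q).[s] * t.

Let curve_lift_pi p : curve_lift (curve_pi p) = in2 p.
Proof.
have E (h : curve) : curve_lift h = in2 (val h) by [].
have /curve_relP [q pE] : curve_pi (p - val (curve_pi p)) = 0.
  by rewrite rmorphB [X in _ - X]curve_valK subrr.
rewrite E -[in RHS](subrK (val (curve_pi p)) p) pE rmorphD rmorphM.
rewrite [in2 curve_rel](_ : _ = 0) ?mulr0 ?add0r //.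
rewrite /curve_rel -mul_polyC rmorphB rmorphXn rmorphD rmorphM.
by rewrite in2X !in2C st_rel [in1 Q * t + _]addrC; exact: subrr.
Qed.

Lemma curve_lift_zmod : zmod_morphism curve_lift.
Proof.
move=> h k; rewrite -(curve_valK h) -(curve_valK k) -[_ - _]rmorphB.
by rewrite !curve_lift_pi rmorphB.
Qed.

Lemma curve_lift_monoid : monoid_morphism curve_lift.
Proof.
split=> [|h k]; first by rewrite -(rmorph1 curve_pi) curve_lift_pi rmorph1.
rewrite -(curve_valK h) -(curve_valK k) -[_ * _]rmorphM.
by rewrite !curve_lift_pi rmorphM.
Qed.

Lemma curve_lift_alg c : curve_lift c%:A = u c.
Proof. by rewrite -curve_piC curve_lift_pi in2C in1C. Qed.

Lemma curve_lift_f : curve_lift curve_f = s.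
Proof. by rewrite curve_lift_pi in2C in1X. Qed.

Lemma curve_lift_g : curve_lift curve_g = t.
Proof. by rewrite curve_lift_pi in2X. Qed.

End Lift.

(* The A-derivation with D f = 2 g - Q(f) and D g = P'(f) + Q'(f) g; the two  *)
(* terms are the partial derivatives along f and g of a representative of h   *)
(* in A[f][g].                                                                *)

Definition curve_Df : curve := 2 * curve_g - horner_alg curve_f Q.
Definition curve_Dg : curve :=
  horner_alg curve_f P^`() + horner_alg curve_f Q^`() * curve_g.

Definition curve_D (h : curve) : curve :=
  curve_pi (map_poly (@deriv A) (val h)) * curve_Df
  + curve_pi (val h)^`() * curve_Dg.

Let Dl (p : {poly {poly A}}) : curve :=
  curve_pi (map_poly (@deriv A) p) * curve_Df + curve_pi p^`() * curve_Dg.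

Let map_derivM (p q : {poly {poly A}}) :
  map_poly (@deriv A) (p * q)
  = map_poly (@deriv A) p * q + p * map_poly (@deriv A) q.
Proof.
apply/polyP => i; rewrite coefD coef_map !coefM raddf_sum -big_split /=.
by apply: eq_bigr => j _; rewrite derivM !coef_map.
Qed.

Let DlB p q : Dl (p - q) = Dl p - Dl q.
Proof. by rewrite /Dl !raddfB /= !mulrBl opprD addrACA. Qed.

Let DlM p q : Dl (p * q) = Dl p * curve_pi q + curve_pi p * Dl q.
Proof.
by rewrite /Dl map_derivM derivM !rmorphD !rmorphM /=; ring.
Qed.

Let DlC c : Dl c%:P = curve_pi (c^`())%:P * curve_Df.
Proof. by rewrite /Dl map_polyC derivC rmorph0 mul0r addr0. Qed.

Let DlX : Dl 'X = curve_Dg.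
Proof.
rewrite /Dl derivX rmorph1 mul1r [map_poly _ _](_ : _ = 0).
  by rewrite rmorph0 mul0r add0r.
by apply/polyP => i; rewrite coef_map coefX coef0 /= -polyC_natr derivC.
Qed.

Let DlD p q : Dl (p + q) = Dl p + Dl q.
Proof. by rewrite /Dl !raddfD /= !mulrDl addrACA. Qed.

Let Dl_rel : Dl curve_rel = 0.
Proof.
rewrite /curve_rel -mul_polyC DlB DlD expr2 !DlM !DlX !DlC -/curve_g.
rewrite -!horner_cf /curve_Df /curve_Dg.
ring.
Qed.

Let Dl_pi p : curve_D (curve_pi p) = Dl p.
Proof.
have E (h : curve) : curve_D h = Dl (val h) by [].
have /curve_relP [q pE] : curve_pi (p - val (curve_pi p)) = 0.
  by rewrite rmorphB [X in _ - X]curve_valK subrr.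
rewrite E -[in RHS](subrK (val (curve_pi p)) p) pE DlD DlM Dl_rel.
by rewrite curve_pi_rel !mulr0 !add0r.
Qed.

Lemma curve_D_f : curve_D curve_f = curve_Df.
Proof. by rewrite Dl_pi DlC derivX polyC1 rmorph1 mul1r. Qed.

Lemma curve_D_g : curve_D curve_g = curve_Dg.
Proof. by rewrite Dl_pi DlX. Qed.

Lemma curve_DB h k : curve_D (h - k) = curve_D h - curve_D k.
Proof.
by rewrite -(curve_valK h) -(curve_valK k) -[curve_pi _ - _]rmorphB !Dl_pi DlB.
Qed.

Lemma curve_DM h k : curve_D (h * k) = curve_D h * k + h * curve_D k.
Proof.
by rewrite -(curve_valK h) -(curve_valK k) -[curve_pi _ * _]rmorphM !Dl_pi DlM.
Qed.

Lemma curve_DC c : curve_D c%:A = 0.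
Proof. by rewrite -curve_piC Dl_pi DlC derivC rmorph0 mul0r. Qed.

Lemma curve_DZ c h : curve_D (c *: h) = c *: curve_D h.
Proof. by rewrite -mulr_algl curve_DM curve_DC mul0r add0r mulr_algl. Qed.

End Curve.

Lemma sum_pick2 (S : comNzRingType) (n : nat) (i j : 'I_n)
    (c t : 'I_n -> 'I_n -> S) :
  (i <= j)%N ->
  (forall k l : 'I_n, (k <= l)%N -> c k l = ((k == i) && (l == j))%:R) ->
  \sum_(k < n) \sum_(l < n | (k <= l)%N) c k l * t k l = t i j.
Proof.
move=> ij cE; rewrite (bigD1 i) //= [X in _ + X]big1 => [|k ki].
  rewrite addr0 (bigD1 j) //= [X in _ + X]big1 => [|l /andP[il lj]].
    by rewrite cE // !eqxx mul1r addr0.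
  by rewrite cE // (negPf lj) andbF mul0r.
by rewrite big1 // => l kl; rewrite cE // (negPf ki) mul0r.
Qed.

Lemma sum_lin2 (S : comNzRingType) (n : nat) (s : S)
    (c c1 c2 t : 'I_n -> 'I_n -> S) :
  (forall k l, c k l = s * c1 k l + c2 k l) ->
  \sum_(k < n) \sum_(l < n | (k <= l)%N) c k l * t k l
  = s * (\sum_(k < n) \sum_(l < n | (k <= l)%N) c1 k l * t k l)
    + \sum_(k < n) \sum_(l < n | (k <= l)%N) c2 k l * t k l.
Proof.
move=> cE; rewrite mulr_sumr -big_split; apply: eq_bigr => k _ /=.
rewrite mulr_sumr -big_split; apply: eq_bigr => l _ /=.
by rewrite cE mulrDl mulrA.
Qed.

Lemma sum_sym2 (S : comNzRingType) (n : nat) (c d x y : 'I_n -> S) :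
  \sum_(k < n) c k * \sum_(l < n) d l * (x k * y l + x l * y k)
  = (\sum_(k < n) c k * x k) * (\sum_(k < n) d k * y k)
    + (\sum_(k < n) d k * x k) * (\sum_(k < n) c k * y k).
Proof.
rewrite [X in _ + X]mulrC !mulr_suml -big_split; apply: eq_bigr => k _ /=.
rewrite !mulr_sumr -big_split; apply: eq_bigr => l _ /=; ring.
Qed.

Section EvenAlgebra.

Variables (K : fieldType) (a : 'I_5 -> K) (b : 'I_3 -> K).

Definition P_ev : {poly K} := \sum_(i < 5) a i *: 'X^i.
Definition Q_ev : {poly K} := \sum_(j < 3) b j *: 'X^j.

Definition F_ev := curve P_ev Q_ev.
HB.instance Definition _ := GRing.ComNzRing.on F_ev.
HB.instance Definition _ := GRing.Algebra.on F_ev.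

Notation F := F_ev.

Definition f_ev : F := curve_f P_ev Q_ev.
Definition g_ev : F := curve_g P_ev Q_ev.

Lemma g2E : g_ev ^+ 2 = horner_alg f_ev P_ev + horner_alg f_ev Q_ev * g_ev.
Proof. exact: curve_relE. Qed.

Local Notation PF := (map_poly (in_alg F) P_ev).
Local Notation QF := (map_poly (in_alg F) Q_ev).

(* F (x) F over K, as the extension of scalars of F to the left factor F.     *)
Definition FF_ev :=
  curve PF QF.
HB.instance Definition _ := GRing.ComNzRing.on FF_ev.
HB.instance Definition _ := GRing.Algebra.on FF_ev.

Notation FF := FF_ev.

(* h (x) 1 and 1 (x) h *)
Definition tensl (h : F) : FF := h%:A.
Definition tensr : F -> FF :=
  curve_lift (in_alg FF \o in_alg F) (curve_f PF QF) (curve_g PF QF).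

HB.instance Definition _ := GRing.RMorphism.copy tensl (in_alg FF).

Let tensr_rel : let u := in_alg FF \o in_alg F in
  curve_g PF QF ^+ 2 = (map_poly u P_ev).[curve_f PF QF]
  + (map_poly u Q_ev).[curve_f PF QF] * curve_g PF QF.
Proof. by rewrite /= !map_poly_comp; exact: curve_relE. Qed.

HB.instance Definition _ :=
  GRing.isZmodMorphism.Build F FF tensr (curve_lift_zmod tensr_rel).
HB.instance Definition _ :=
  GRing.isMonoidMorphism.Build F FF tensr (curve_lift_monoid tensr_rel).

Lemma tensr_alg c : tensr c%:A = tensl c%:A.
Proof. exact: (curve_lift_alg tensr_rel). Qed.

Lemma tensr_f : tensr f_ev = curve_f PF QF.
Proof. exact: (curve_lift_f tensr_rel). Qed.

Lemma tensr_g : tensr g_ev = curve_g PF QF.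
Proof. exact: (curve_lift_g tensr_rel). Qed.

(* FF is the coproduct of two copies of F among commutative K-algebras.       *)
Lemma FF_univ (S : comNzRingType) (u v : {rmorphism F -> S}) :
  (forall c : K, u c%:A = v c%:A) ->
  exists w : {rmorphism FF -> S},
    [/\ forall h, w (tensl h) = u h, forall h, w (tensr h) = v h
      & forall w' : {rmorphism FF -> S},
          (forall h, w' (tensl h) = u h) -> (forall h, w' (tensr h) = v h) ->
          w' =1 w].
Proof.
move=> uv; pose w : FF -> S := curve_lift (A := F) u (v f_ev) (v g_ev).
have mapE (p : {poly K}) :
    (map_poly u (map_poly (in_alg F) p)).[v f_ev] = v (horner_alg f_ev p).
  rewrite -map_poly_comp /= (eq_map_poly (g := v \o in_alg F)); last exact: uv.
  by rewrite map_poly_comp horner_map.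
have rel :
    v g_ev ^+ 2 = (map_poly u PF).[v f_ev] + (map_poly u QF).[v f_ev] * v g_ev.
  by rewrite !mapE -rmorphM -rmorphD -rmorphXn g2E.
pose W : {rmorphism FF -> S} := HB.pack w
  (GRing.isZmodMorphism.Build _ _ w (curve_lift_zmod rel))
  (GRing.isMonoidMorphism.Build _ _ w (curve_lift_monoid rel)).
have Wl h : W (tensl h) = u h by exact: (curve_lift_alg rel).
have Wf : W (curve_f PF QF) = v f_ev by exact: (curve_lift_f rel).
have Wg : W (curve_g PF QF) = v g_ev by exact: (curve_lift_g rel).
exists W; split=> // [h|w' w'l w'r].
  apply: (curve_lift_uniq (u := u \o in_alg F)
    (s := v f_ev) (t := v g_ev) (w := W \o tensr)).
  - by move=> c; exact: etrans (congr1 W (tensr_alg c)) (Wl _).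
  - exact: etrans (congr1 W tensr_f) Wf.
  - exact: etrans (congr1 W tensr_g) Wg.
  - by move=> c /=; rewrite uv.
  - by [].
  - by [].
apply: (curve_lift_uniq (u := u) (s := v f_ev) (t := v g_ev)).
- exact: w'l.
- by rewrite -tensr_f w'r.
- by rewrite -tensr_g w'r.
- exact: Wl.
- exact: Wf.
- exact: Wg.
Qed.

Lemma lreg_f1Bf2 : GRing.lreg (tensl f_ev - tensr f_ev).
Proof.
have -> : tensl f_ev - tensr f_ev = curve_pi PF QF (f_ev%:P - 'X)%:P.
  have e1 : tensl f_ev = curve_pi PF QF f_ev%:P%:P.
    by symmetry; exact: (curve_piC PF QF f_ev).
  have e2 : tensr f_ev = curve_pi PF QF 'X%:P by exact: tensr_f.
  by rewrite e1 e2 -raddfB -polyCB.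
set c := f_ev%:P - 'X; have rc : GRing.lreg c.
  apply: lreg_lead; rewrite /c -opprB lead_coefN lead_coefXsubC.
  by apply: lregN; exact: lreg1.
have valM (h : FF) :
    val (curve_pi PF QF c%:P * h) = c *: (val h : {poly {poly F}}).
  rewrite -[h in LHS]curve_valK -rmorphM curve_pi_val mul_polyC //.
  by rewrite (leq_trans (size_scale_leq _ _)) ?size_curve.
move=> h k /(congr1 val); rewrite !valM => /polyP hk.
apply: val_inj; apply/polyP => i; apply: rc.
by have := hk i; rewrite !coefZ.
Qed.

Let f1 := tensl f_ev.
Let f2 := tensr f_ev.
Let g1 := tensl g_ev.
Let g2 := tensr g_ev.
Let halfQ := 2^-1 *: horner_alg f_ev Q_ev.

Definition lambda_ev : {totfrac FF} :=
  fract (g1 + g2 - tensl halfQ - tensr halfQ) (f1 - f2).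

Lemma lambda_evP :
  tofrac (f1 - f2) * lambda_ev
  = tofrac (g1 + g2 - tensl halfQ - tensr halfQ).
Proof. exact: TotalFrac.fractP lreg_f1Bf2. Qed.

Definition D_ev : F -> F := @curve_D K P_ev Q_ev.

Lemma D_evP :
  [/\ forall c h k, D_ev (c *: h + k) = c *: D_ev h + D_ev k,
      forall h k, D_ev (h * k) = D_ev h * k + h * D_ev k,
      D_ev f_ev = 2 * g_ev - horner_alg f_ev Q_ev
    & D_ev g_ev = horner_alg f_ev P_ev^`() + horner_alg f_ev Q_ev^`() * g_ev].
Proof.
split; [| exact: curve_DM | exact: curve_D_f | exact: curve_D_g] => c h k.
rewrite /D_ev -[k in LHS]opprK curve_DB curve_DZ -[- k]sub0r curve_DB.
by rewrite -[0](scale0r k) curve_DZ scale0r sub0r opprK.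
Qed.

(* The generator x_i, for i = 0, 2, 3, 4, ...                                 *)
Definition x_ev (i : nat) : F :=
  if odd i then f_ev ^+ (i - 3)./2 * g_ev else f_ev ^+ i./2.

Variable n : nat.

(* The n generators x_0, x_2, x_3, ..., x_n are indexed by 'I_n.              *)
Definition gen_index (k : 'I_n) : nat := if k == 0%N :> nat then 0%N else k.+1.

Definition gen_ev (k : 'I_n) : F := x_ev (gen_index k).

(* A vector u of coordinates defines an element of F_n, as an element of F    *)
(* and as a linear form in S^* F_n.                                           *)
Definition vec_F (u : 'I_n -> K) : F := \sum_(k < n) u k *: gen_ev k.
Definition vec_S (u : 'I_n -> K) : {mpoly K[n]} := \sum_(k < n) u k *: 'X_k.

Definition in_Fn (h : F) : Prop := exists u, h = vec_F u.

(* S^2 F_n -> F_n (x) F_n, x_k x_l |-> x_k (x) x_l + x_l (x) x_k              *)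
Definition S2_tensor (p : {mpoly K[n]}) : FF :=
  \sum_(k < n) \sum_(l < n | (k <= l)%N)
    tensl (p@_(U_(k) + U_(l)))%:A
    * (tensl (gen_ev k) * tensr (gen_ev l)
       + tensl (gen_ev l) * tensr (gen_ev k)).

Definition in_S2Fn (z : {totfrac FF}) : Prop :=
  exists2 p : {mpoly K[n]}, p \is 2.-homog & z = tofrac (S2_tensor p).

Definition formula_ev (phi psi : F) : {totfrac FF} :=
  n%:R * lambda_ev * tofrac (tensl phi * tensr psi - tensl psi * tensr phi)
  + tofrac (tensl phi * tensr (D_ev psi) + tensr phi * tensl (D_ev psi)
            - tensl psi * tensr (D_ev phi) - tensr psi * tensl (D_ev phi)).

Lemma mnm2_eq (i j k l : 'I_n) : (i <= j)%N -> (k <= l)%N ->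
  (U_(i) + U_(j) == U_(k) + U_(l))%MM = (k == i) && (l == j).
Proof.
move=> ij kl; apply/eqP/andP => [E|[/eqP-> /eqP->]//].
have E' t : ((i == t) + (j == t) = (k == t) + (l == t))%N.
  by move/mnmP/(_ t): E; rewrite !mnmDE !mnm1E.
have [ki|nki] := eqVneq k i.
  split=> //; have := E' j; rewrite ki eqxx => /addnI.
  by case: (l == j).
have := E' i; rewrite eqxx (negPf nki); case: (eqVneq l i) => [li _|_];
  last by case: (j == i).
have := E' k; rewrite eqxx [i == k]eq_sym (negPf nki).
case: (eqVneq j k) => [jk _|_]; last by case: (l == k).
case/eqP: nki; apply: val_inj; apply/eqP; rewrite eqn_leq.
by rewrite -{2}jk ij andbT -li kl.
Qed.

Lemma S2_tensorX (i j : 'I_n) :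
  S2_tensor ('X_i * 'X_j)
  = tensl (gen_ev i) * tensr (gen_ev j) + tensl (gen_ev j) * tensr (gen_ev i).
Proof.
wlog ij : i j / (i <= j)%N.
  move=> H; have [/H //|/ltnW /H] := leqP i j.
  by move=> E; rewrite ['X_i * _]mulrC E; exact: addrC.
have cE (k l : 'I_n) : (k <= l)%N ->
    ('X_i * 'X_j : {mpoly K[n]})@_(U_(k) + U_(l)) = ((k == i) && (l == j))%:R.
  by move=> kl; rewrite -mpolyXD mcoeffX mnm2_eq.
apply: (sum_pick2 (c := fun k l => tensl _)) => // k l kl.
by rewrite cE //; case: (_ && _); rewrite ?scale1r ?scale0r ?rmorph1 ?rmorph0.
Qed.

Lemma S2_tensorP (c : K) (p q : {mpoly K[n]}) :
  S2_tensor (c *: p + q) = tensl c%:A * S2_tensor p + S2_tensor q.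
Proof.
apply: sum_lin2 => k l.
by rewrite mcoeffD mcoeffZ scalerDl -scalerA -mulr_algl !rmorphD !rmorphM.
Qed.

Let S2_tensor0 : S2_tensor 0 = 0.
Proof.
apply: big1 => k _; apply: big1 => l _.
rewrite mcoeff0 scale0r rmorph0; exact: mul0r.
Qed.

Let S2_tensor_sum (u : 'I_n -> K) (p : 'I_n -> {mpoly K[n]}) :
  S2_tensor (\sum_(k < n) u k *: p k)
  = \sum_(k < n) tensl (u k)%:A * S2_tensor (p k).
Proof.
elim/big_rec2: _ => [|k z q _ <-]; first exact: S2_tensor0.
exact: S2_tensorP.
Qed.

Let tens_vec_F (u : 'I_n -> K) :
  tensl (vec_F u) = \sum_(k < n) tensl (u k)%:A * tensl (gen_ev k) /\
  tensr (vec_F u) = \sum_(k < n) tensl (u k)%:A * tensr (gen_ev k).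
Proof.
rewrite /vec_F !raddf_sum; split; apply: eq_bigr => k _.
  by rewrite -[u k *: gen_ev k]mulr_algl; exact: rmorphM.
by rewrite -[u k *: gen_ev k]mulr_algl -tensr_alg; exact: rmorphM.
Qed.

Lemma S2_tensorM (u v : 'I_n -> K) :
  S2_tensor (vec_S u * vec_S v)
  = tensl (vec_F u) * tensr (vec_F v) + tensl (vec_F v) * tensr (vec_F u).
Proof.
have [-> ->] := tens_vec_F u; have [-> ->] := tens_vec_F v.
transitivity (\sum_(k < n) tensl (u k)%:A *
    S2_tensor (\sum_(l < n) v l *: ('X_k * 'X_l))).
  rewrite -S2_tensor_sum /vec_S mulr_suml; congr S2_tensor.
  apply: eq_bigr => k _; rewrite -scalerAl mulr_sumr; congr (_ *: _).
  by apply: eq_bigr => l _; rewrite -scalerAr.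
transitivity (\sum_(k < n) tensl (u k)%:A * \sum_(l < n) tensl (v l)%:A *
    (tensl (gen_ev k) * tensr (gen_ev l) + tensl (gen_ev l) * tensr (gen_ev k))).
  apply: eq_bigr => k _; rewrite S2_tensor_sum; congr (_ * _).
  by apply: eq_bigr => l _; rewrite S2_tensorX.
exact: sum_sym2.
Qed.

End EvenAlgebra.

Section Poisson.

Variables (K : fieldType) (n : nat).

Local Notation A := {mpoly K[n]}.

Definition bracket := A -> A -> A.

Record is_biderivation (B : bracket) : Prop := IsBiderivation {
  biderivation_linear_l : forall c p q r, B (c *: p + q) r = c *: B p r + B q r;
  biderivation_linear_r : forall c p q r, B r (c *: p + q) = c *: B r p + B r q;
  biderivation_leibniz_l : forall p q r, B (p * q) r = p * B q r + B p r * q;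
  biderivation_leibniz_r : forall p q r, B r (p * q) = p * B r q + B r p * q
}.

Record is_poisson (B : bracket) : Prop := IsPoisson {
  poisson_biderivation : is_biderivation B;
  poisson_antisym : forall p q, B p q = - B q p;
  poisson_jacobi : forall p q r, B p (B q r) + B q (B r p) + B r (B p q) = 0
}.

(* 0 belongs to d.-homog for every d *)
Definition is_quadratic (B : bracket) : Prop :=
  forall i j : 'I_n, B 'X_i 'X_j \is 2.-homog.

Definition compatible (B B' : bracket) : Prop :=
  forall u : K, is_poisson (fun p q => B p q + u *: B' p q).

End Poisson.

(* B is the extension by the Leibniz rule of the bracket given by formula_ev  *)
(* on F_n; S2_tensor only sees the homogeneous component of degree 2, hence   *)
(* the homogeneity condition.                                                 *)
Definition is_ev_bracket (K : fieldType) (a : 'I_5 -> K) (b : 'I_3 -> K)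
    (n : nat) (B : bracket K n) : Prop :=
  is_biderivation B /\
  forall u v : 'I_n -> K,
    B (vec_S u) (vec_S v) \is 2.-homog /\
    tofrac (S2_tensor a b (B (vec_S u) (vec_S v)))
    = formula_ev n (vec_F a b u) (vec_F a b v).

(* Main.v *)
Require Import Defs.
From mathcomp Require Import all_boot all_order all_algebra.
From mathcomp Require Import reals complex mpoly ring zify.

Set Implicit Arguments.
Unset Strict Implicit.
Unset Printing Implicit Defensive.

Import GRing.Theory Num.Theory.
Local Open Scope ring_scope.

(** Write y = g - Q(f)/2. Then y^2 = R(f) with R = P + Q^2/4, D f = 2 y and
    D y = R'(f), and lambda = (y_1 + y_2)/(f_1 - f_2). Put
    E phi = n y phi - f D phi and u ^ v = u (x) v - v (x) u. Multiplied by
    f_1 - f_2, the bracket of phi and psi becomes the antisymmetric tensor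

      N = E phi ^ psi - E psi ^ phi + f phi ^ D psi - f psi ^ D phi.

    Values in S^2 F_n. Give f^i weight i and f^i g weight i + 2. For n = 2m,
    F_n consists of the elements of weight at most m. On F_n the maps f and D
    raise the weight by at most one, and so does E, although y raises it by two:
    on an element of top weight m the leading terms of n y phi and f D phi
    cancel. This is the reason for the coefficient n of lambda. So both factors
    of every term of N lie in F_{n+2}; as N vanishes on the diagonal it is a
    multiple of f_1 - f_2, and the quotient lies in F_n (x) F_n. It is symmetric
    because N and f_1 - f_2 are antisymmetric (numer_diag, fits_euler, fits_der,
    quo_mulP, quo_sym).

    Linearity. In the basis f^i, f^i g the matrices of g and D are affine in the
    coefficients of P and Q, hence so are N and its quotient. With one more
    coefficient z in front of the constant part, the bracket becomes linear in
    (z, P, Q); the bracket of the theorem is the one with z = 1, and the nine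
    brackets are the values at the nine monomial triples.

    Jacobi identity. A tensor of degree three is tested at three generic points
    of the curve whose differences f_i - f_j are invertible (three_points). There
    {phi, psi} = A_12 psi_2 + A_21 psi_1 for the operator
    A_ij = n lambda_ij phi_i + phi_i D_j - (D phi)_i, and after expansion the
    cyclic sum cancels identically, apart from the terms with a derivative of
    lambda. They enter through (D_i + D_j) lambda_ij only. As R has degree at
    most four, this is h(f_i) - h(f_j) with h(f) = c_3 f + 2 c_4 f^2, where c_3
    and c_4 are the coefficients of f^3 and f^4 in R (Dlambda_sub), and such
    differences add up to zero over the three pairs (jsum_cyc).

    Compatibility. Rescaling gives the Jacobi identity for every z != 0, and it
    extends to z = 0 because it is quadratic in the bracket (poisson_limit). So
    every linear combination of the nine brackets is a Poisson bracket.

    Finally, tensors x_k (x) x_l are linearly independent in F (x) F, so that the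
    values on F_n, and with them the bracket, are determined by the formula
    (ev_bracket_spec, ev_bracket_unique). *)

(** * Division of a table of coefficients by the difference of the variables *)

Section DividedTable.

Variables (K : comNzRingType) (N : nat -> nat -> K).

(** For sum_ij N_ij s^i t^j a multiple of s - t, the coefficients of the quotient
    satisfy w_(i, j) = N_(i+1, j) + w_(i+1, j-1), which unrolls to this sum. *)
Definition divtab (i j : nat) : K := \sum_(d < j.+1) N (i + d).+1 (j - d).

Lemma divtab0 i : divtab i 0 = N i.+1 0.
Proof. by rewrite /divtab big_ord_recl big_ord0 addr0 addn0. Qed.

Lemma divtabS i j : divtab i j.+1 = N i.+1 j.+1 + divtab i.+1 j.
Proof.
rewrite /divtab big_ord_recl addn0; congr (_ + _).
by apply: eq_bigr => d _; rewrite addSnnS.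
Qed.

Hypothesis N_diag : forall c, \sum_(d < c.+1) N d (c - d) = 0.

Lemma divtab_top j : divtab 0 j = - N 0 j.+1.
Proof.
apply/eqP; rewrite -addr_eq0 addrC -(N_diag j.+1) big_ord_recl; apply/eqP.
by congr (_ + _); apply: eq_bigr.
Qed.

(** Along an antidiagonal the entries of N add up to zero, so the sum of the
    entries below a position is minus the sum of those above it. This form gives
    the bound on the column index and the symmetry of the quotient. *)
Lemma divtab_flip i j : divtab i j = - \sum_(d < i.+1) N (i - d) (j + d).+1.
Proof.
elim: i j => [|i IHi] j.
  by rewrite divtab_top big_ord_recl big_ord0 addr0 addn0.
rewrite -[LHS](addKr (N i.+1 j.+1)) -divtabS IHi -opprD.
rewrite [in RHS]big_ord_recl addn0; congr (- (_ + _)).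
by apply: eq_bigr => d _; rewrite addSnnS.
Qed.

Lemma divtabK i j :
  N i j = (if i is i'.+1 then divtab i' j else 0)
        - (if j is j'.+1 then divtab i j' else 0).
Proof.
case: i j => [|i] [|j].
- by have := N_diag 0; rewrite big_ord_recl big_ord0 !subr0 addr0.
- by rewrite divtab_top sub0r opprK.
- by rewrite divtab0 subr0.
- by rewrite divtabS addrK.
Qed.

Variables L L' : nat.
Hypothesis N_row : forall i j, (L < i)%N -> N i j = 0.
Hypothesis N_col : forall i j, (L' < j)%N -> N i j = 0.

Lemma divtab_row i j : (L <= i)%N -> divtab i j = 0.
Proof.
by move=> Li; apply: big1 => d _; rewrite N_row // ltnS (leq_trans Li) ?leq_addr.
Qed.

Lemma divtab_col i j : (L' <= j)%N -> divtab i j = 0.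
Proof.
move=> Lj; rewrite divtab_flip big1 ?oppr0 // => d _.
by rewrite N_col // ltnS (leq_trans Lj) ?leq_addr.
Qed.

(** The relation (s - t) w = N tested against an arbitrary array b, in place of
    the powers s^i t^j: multiplication by s and t shifts the indices of b. *)
Lemma sum_divtab (T : comNzRingType) (k : {rmorphism K -> T})
    (b : nat -> nat -> T) :
  \sum_(i < L) \sum_(j < L') k (divtab i j) * (b i.+1 j - b i j.+1)
  = \sum_(i < L.+1) \sum_(j < L'.+1) k (N i j) * b i j.
Proof.
pose s1 := \sum_(i < L.+1) \sum_(j < L'.+1)
  k (if val i is i'.+1 then divtab i' j else 0) * b i j.
pose s2 := \sum_(i < L.+1) \sum_(j < L'.+1)
  k (if val j is j'.+1 then divtab i j' else 0) * b i j.
transitivity (s1 - s2).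
  have -> : s1 = \sum_(i < L) \sum_(j < L') k (divtab i j) * b i.+1 j.
    rewrite /s1 big_ord_recl big1 ?add0r => [|j _]; last by rewrite rmorph0 mul0r.
    apply: eq_bigr => i _; rewrite big_ord_recr /= divtab_col // rmorph0 mul0r.
    by rewrite addr0.
  have -> : s2 = \sum_(i < L) \sum_(j < L') k (divtab i j) * b i j.+1.
    rewrite /s2 big_ord_recr /= [X in _ + X = _]big1 ?addr0 => [|j _]; last first.
      by case: j => [[|j] ?] /=; rewrite ?divtab_row ?rmorph0 ?mul0r.
    apply: eq_bigr => i _; rewrite big_ord_recl rmorph0 mul0r add0r.
    by apply: eq_bigr.
  rewrite -sumrB; apply: eq_bigr => i _; rewrite -sumrB.
  by apply: eq_bigr => j _; rewrite mulrBr.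
rewrite -sumrB; apply: eq_bigr => i _; rewrite -sumrB.
by apply: eq_bigr => j _; rewrite [N i j]divtabK rmorphB mulrBl.
Qed.

End DividedTable.

(** * The curve algebra in coordinates *)

(** A pair (p, q) stands for the element p(f) + q(f) g of the algebra, so that
    brackets for different P and Q act on the same space. The triple (z, P, Q) contains the curve and the
    homogenizing coefficient z, which is 1 for the curve itself. *)
Notation pair_poly K := ({poly K} * {poly K})%type.
Notation param K := (K^o * {poly K} * {poly K})%type.

Section Pairs.

Variable K : numFieldType.

Definition coord (e : bool) (h : pair_poly K) : {poly K} := if e then h.2 else h.1.

Lemma coordP c h h' e : coord e (c *: h + h') = c *: coord e h + coord e h'.
Proof. by case: e. Qed.

Definition mon (e : bool) (i : nat) : pair_poly K :=
  if e then (0, 'X^i) else ('X^i, 0).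

Definition mul_f (h : pair_poly K) : pair_poly K := ('X * h.1, 'X * h.2).

(** Multiplication by y = g - Q(f)/2, by g^2 = P + Q g; the factor z makes it
    linear in (z, P, Q). *)
Definition mul_y (t : param K) (h : pair_poly K) : pair_poly K :=
  (t.1.2 * h.2 - 2^-1 *: (t.2 * h.1), t.1.1 *: h.1 + 2^-1 *: (t.2 * h.2)).

(** The derivation D, with 2 g - Q = 2 y and (2 g - Q) g = 2 P + Q g substituted;
    again z makes it linear in (z, P, Q). *)
Definition der (t : param K) (h : pair_poly K) : pair_poly K :=
  (2 *: (h.2^`() * t.1.2) + h.2 * t.1.2^`() - h.1^`() * t.2,
   (2 * t.1.1) *: h.1^`() + h.2^`() * t.2 + h.2 * t.2^`()).

(** Up to terms of lower weight, f D multiplies an element of weight i by 2 i y,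
    so this operator kills the top weight n/2. *)
Definition euler (n : nat) (t : param K) (h : pair_poly K) : pair_poly K :=
  n%:R *: mul_y t h - mul_f (der t h).

Lemma mul_fP c h h' : mul_f (c *: h + h') = c *: mul_f h + mul_f h'.
Proof. by rewrite /mul_f; congr pair; rewrite /= mulrDr scalerAr. Qed.

Ltac polyring := rewrite -?mul_polyC ?polyCM; ring.

Lemma mul_yP t c h h' : mul_y t (c *: h + h') = c *: mul_y t h + mul_y t h'.
Proof. rewrite /mul_y; congr pair => /=; polyring. Qed.

Lemma mul_y_paramP c t t' h : mul_y (c *: t + t') h = c *: mul_y t h + mul_y t' h.
Proof.
rewrite /mul_y; congr pair => /=; rewrite -!mul_polyC ?polyCD ?polyCM; ring.
Qed.

Lemma derP t c h h' : der t (c *: h + h') = c *: der t h + der t h'.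
Proof.
rewrite /der; congr pair => /=; rewrite !derivD !derivZ; polyring.
Qed.

Lemma der_paramP c t t' h : der (c *: t + t') h = c *: der t h + der t' h.
Proof.
rewrite /der; congr pair => /=; rewrite ?derivD ?derivZ -!mul_polyC ?polyCM ?polyCD ?polyCM; ring.
Qed.

Lemma eulerP n t c h h' : euler n t (c *: h + h') = c *: euler n t h + euler n t h'.
Proof.
rewrite /euler mul_yP derP mul_fP scalerDr scalerBr !scalerA [n%:R * c]mulrC.
by rewrite opprD addrACA.
Qed.

Lemma euler_paramP n c t t' h : euler n (c *: t + t') h = c *: euler n t h + euler n t' h.
Proof.
rewrite /euler mul_y_paramP der_paramP mul_fP scalerDr scalerBr !scalerA [n%:R * c]mulrC.
by rewrite opprD addrACA.
Qed.

(** The numbers of monomials f^i and f^i g in F_2m for m > 0: i <= m and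
    i <= m - 2. *)
Definition bound (m : nat) (e : bool) : nat := if e then m.-1 else m.+1.

Definition fits (L : bool -> nat) (h : pair_poly K) : Prop :=
  forall e j, (L e <= j)%N -> (coord e h)`_j = 0.

Lemma fitsP L c h h' : fits L h -> fits L h' -> fits L (c *: h + h').
Proof.
by move=> Lh Lh' e j Lj; rewrite coordP coefD coefZ Lh // Lh' // mulr0 addr0.
Qed.

Lemma fits0 L : fits L 0.
Proof. by move=> [] j _; rewrite /coord /= coef0. Qed.

Lemma fits_sum L (I : Type) (r : seq I) (p : pred I) (c : I -> K) (F : I -> pair_poly K) :
  (forall i, p i -> fits L (F i)) -> fits L (\sum_(i <- r | p i) c i *: F i).
Proof.
move=> LF; elim/big_ind: _ => [|x y Lx Ly|i pi]; first exact: fits0.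
  by rewrite -[x]scale1r; exact: fitsP.
by rewrite -[_ *: _]addr0; apply: fitsP; [exact: LF | exact: fits0].
Qed.

Lemma fits_mon L e i : (i < L e)%N -> fits L (mon e i).
Proof.
move=> iL e' j; rewrite /mon; case: e iL; case: e' => iL Lj; rewrite /coord /= ?coef0 // coefXn.
  by case: eqP => // ji; move: Lj; rewrite ji leqNgt iL.
by case: eqP => // ji; move: Lj; rewrite ji leqNgt iL.
Qed.

Lemma fits_expand L h : fits L h ->
  h = \sum_(e : bool) \sum_(i < L e) (coord e h)`_i *: mon e i.
Proof.
move=> Lh; have E e : coord e h = \sum_(i < L e) (coord e h)`_i *: 'X^i.
  rewrite -poly_def; apply/polyP => j; rewrite coef_poly.
  by case: ltnP => // /Lh.
rewrite big_bool /=; rewrite [h in LHS]surjective_pairing.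
rewrite -[h.1]/(coord false h) -[h.2]/(coord true h) [in LHS]E [in X in (_, X)]E.
rewrite [RHS]surjective_pairing; congr pair.
  rewrite !(raddfD, raddf_sum) /=.
  rewrite [X in X + _]big1 ?add0r; last by move=> i _; rewrite scaler0.
  by apply: eq_bigr.
rewrite !(raddfD, raddf_sum) /=.
rewrite [X in _ + X]big1 ?addr0; last by move=> i _; rewrite scaler0.
by apply: eq_bigr.
Qed.

End Pairs.

(** * The bracket multiplied by the difference of the variables *)

Section Numerator.

Variable K : numFieldType.

Definition alt_coef (u v : pair_poly K) (e e' : bool) (i j : nat) : K :=
  (coord e u)`_i * (coord e' v)`_j - (coord e v)`_i * (coord e' u)`_j.

(** The coefficients of f^i g^e (x) f^j g^e' in the product of f_1 - f_2 with the
    bracket of u and v. *)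
Definition numer (n : nat) (t : param K) (u v : pair_poly K) (e e' : bool) (i j : nat) : K :=
  alt_coef (euler n t u) v e e' i j - alt_coef (euler n t v) u e e' i j
  + alt_coef (mul_f u) (der t v) e e' i j - alt_coef (mul_f v) (der t u) e e' i j.

Lemma alt_coef_diag u v e e' c :
  \sum_(d < c.+1) alt_coef u v e e' d (c - d)
  = (coord e u * coord e' v - coord e v * coord e' u)`_c.
Proof. by rewrite coefB !coefM -sumrB. Qed.

(** The terms with der cancel on the diagonal f_1 = f_2. The other ones are
    n (y_1 + y_2) (u_1 v_2 - v_1 u_2); on the diagonal the last factor is a
    multiple of y_1 - y_2, and y_1^2 = y_2^2 there. *)
Lemma numer_diag n t u v e e' c :
  \sum_(d < c.+1) numer n t u v e e' d (c - d) = 0.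
Proof.
rewrite /numer sumrB big_split /= sumrB !alt_coef_diag -coefB -coefD -coefB.
rewrite -[RHS](coef0 K c); apply: (congr1 (fun p : {poly K} => p`_c)).
case: e; case: e'; rewrite /euler /mul_y /mul_f /coord /= -?mul_polyC ?polyCM; ring.
Qed.

Lemma numer_swap n t u v e e' i j :
  numer n t v u e' e j i = numer n t u v e e' i j.
Proof. rewrite /numer /alt_coef; ring. Qed.

Lemma numer_alt n t u v e e' i j :
  numer n t v u e e' i j = - numer n t u v e e' i j.
Proof. rewrite /numer /alt_coef; ring. Qed.

End Numerator.

(** * Degree bounds *)

Section Fits.

Variable K : numFieldType.

Variables (m : nat) (t : param K).
Hypothesis m_gt0 : (0 < m)%N.
Hypothesis P_size : (size t.1.2 <= 5)%N.
Hypothesis Q_size : (size t.2 <= 3)%N.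

Lemma fits_lin (L L' : bool -> nat) (F : pair_poly K -> pair_poly K) h :
  (forall c u v, F (c *: u + v) = c *: F u + F v) ->
  (forall e i, (i < L e)%N -> fits L' (F (mon K e i))) -> fits L h -> fits L' (F h).
Proof.
move=> FP Fm Lh; have F0 : F 0 = 0.
  by have := FP (-1) 0 0; rewrite scaler0 addr0 scaleN1r addNr.
rewrite (fits_expand Lh); elim/big_ind: _ => [|x y Lx Ly|e _].
- by rewrite F0; exact: fits0.
- by rewrite -[x]scale1r FP; exact: fitsP.
elim/big_ind: _ => [|x y Lx Ly|i _].
- by rewrite F0; exact: fits0.
- by rewrite -[x]scale1r FP; exact: fitsP.
by rewrite -[_ *: _]addr0 FP F0; apply: fitsP; [exact: Fm | exact: fits0].
Qed.

Lemma fits_widen (L L' : bool -> nat) (h : pair_poly K) :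
  (forall e, L e <= L' e)%N -> fits L h -> fits L' h.
Proof. by move=> LL Lh e j Lj; apply: Lh; exact: leq_trans (LL e) Lj. Qed.

Definition boundS e := (bound m e).+1.

Lemma fits_mul_f (h : pair_poly K) : fits (bound m) h -> fits boundS (mul_f h).
Proof.
move=> Lh e [//|j]; rewrite /boundS ltnS => Lj.
have -> : coord e (mul_f h) = 'X * coord e h by case: e Lj.
by rewrite coefXM /= Lh.
Qed.

Lemma fits_boundS (h : pair_poly K) : fits (bound m) h -> fits boundS h.
Proof. by apply: fits_widen => e; exact: leqnSn. Qed.

Let P_coef j : (4 < j)%N -> t.1.2`_j = 0.
Proof. by move=> j4; rewrite nth_default // (leq_trans P_size). Qed.
Let Q_coef j : (2 < j)%N -> t.2`_j = 0.
Proof. by move=> j2; rewrite nth_default // (leq_trans Q_size). Qed.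

Lemma fits_der h : fits (bound m) h -> fits boundS (der t h).
Proof.
apply: fits_lin => [c u v|e i ie]; first exact: derP.
have dX (p : {poly K}) : ('X^(i.-1) *+ i) * p = 'X^(i.-1) * (p *+ i).
  by rewrite mulrnAl mulrnAr.
move=> e' j; rewrite /mon /der; case: e ie => ie; case: e' => ij;
  rewrite /coord /= ?derivXn ?deriv0 ?mul0r ?scaler0 ?subr0 ?sub0r ?addr0 ?add0r ?dX;
  rewrite /boundS /bound /= in ie ij.
- rewrite coefD !coefXnM coefMn coef_deriv; case: (ltnP j i) => ji.
    by case: ltnP; [rewrite addr0 | lia].
  rewrite [t.2`_(j - i).+1]Q_coef ?mul0rn ?addr0; last by lia.
  case: i {dX} ie ji => [|i] ie ji; first by rewrite mulr0n ?if_same.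
  by rewrite Q_coef ?mul0rn ?if_same //= ; lia.
- rewrite coefD coefZ !coefXnM coefMn coef_deriv; case: (ltnP j i) => ji.
    by case: ltnP; [rewrite mulr0 addr0 | lia].
  rewrite [t.1.2`_(j - i).+1]P_coef ?mul0rn ?addr0; last by lia.
  case: i {dX} ie ji => [|i] ie ji; first by rewrite mulr0n ?if_same mulr0.
  by rewrite P_coef ?mul0rn ?if_same ?mulr0 //= ; lia.
- rewrite coefZ coefMn coefXn; case: eqP => [ji|_]; last by rewrite mul0rn mulr0.
  by case: i {dX} ie ji => [|i] ie ji; [rewrite mulr0n mulr0 | move: ji => /=; lia].
- rewrite coefN coefXnM coefMn.
  case: i {dX} ie => [|i] ie; first by rewrite mulr0n ?if_same oppr0.
  by rewrite Q_coef ?mul0rn ?if_same ?oppr0 //= ; lia.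
Qed.

(** On f^i the operator gives n y f^i - 2 i y f^i, zero in top degree i = m. On
    f^i g the top coefficients are those of (n - 2 i) P - f P' and of
    (m - i) Q - f Q', and for i = m - 2 these are 4 P - f P' and 2 Q - f Q', where
    the leading terms of the quartic P and the quadratic Q cancel. *)
Lemma fits_euler h : fits (bound m) h -> fits boundS (euler m.*2 t h).
Proof.
apply: fits_lin => [c u v|e i ie]; first exact: eulerP.
have XX (p : {poly K}) : 'X * (('X^(i.-1) *+ i) * p) = ('X^i * p) *+ i.
  case: i ie => [|i] _; first by rewrite mulr0n mul0r mulr0 mulr0n.
  by rewrite mulrnAl mulrnAr mulrA -exprS.
have n2 : m.*2%:R = 2 * m%:R :> K by rewrite -mul2n natrM.
move=> e' j; rewrite /euler /mul_y /mul_f /der /mon; case: e ie => ie; case: e' => ij;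
  rewrite /coord /= ?derivXn ?deriv0 ?mul0r ?mulr0 ?scaler0 ?subr0 ?sub0r ?addr0 ?add0r;
  rewrite /boundS /bound /= in ie ij.
- rewrite mulrDr XX [t.2 * _]mulrC mulrCA !(coefB, coefD, coefZ, coefMn, coefXnM, coefXM, coef_deriv).
  case: (ltnP j i) => ji; first by rewrite mul0rn !mulr0 addr0 subr0.
  have [c2|c3] := leqP (j - i) 2; last first.
    rewrite !Q_coef ?mulr0 ?mul0rn; try lia.
    by case: ifP; rewrite ?mul0rn ?addr0 ?subr0 // Q_coef ?mul0rn ?subr0 //; lia.
  have ji2 : (j - i = 2)%N by lia.
  rewrite ji2 n2; have -> : (m = i.+2)%N by lia.
  have -> : i.+2%:R = i%:R + 2 :> K by rewrite -addn2 natrD.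
  by rewrite /=; field.
- rewrite mulrDr -scalerAr XX mulrCA [t.1.2 * _]mulrC.
  rewrite !(coefB, coefD, coefZ, coefMn, coefXnM, coefXM, coef_deriv).
  case: (ltnP j i) => ji; first by rewrite mul0rn !mulr0 addr0 subr0.
  have [c2|c3] := leqP (j - i) 4; last first.
    rewrite !P_coef ?mulr0 ?mul0rn; try lia.
    by case: ifP; rewrite ?mul0rn ?mulr0 ?addr0 ?subr0 // P_coef ?mul0rn ?mulr0 ?subr0 //; lia.
  have ji2 : (j - i = 4)%N by lia.
  rewrite ji2 n2; have -> : (m = i.+2)%N by lia.
  have -> : i.+2%:R = i%:R + 2 :> K by rewrite -addn2 natrD.
  rewrite /=; ring.
- have -> : 'X * ((2 * t.1.1) *: ('X^(i.-1) *+ i)) = (2 * t.1.1) *: ('X^i *+ i) :> {poly K}.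
    by have := XX 1; rewrite !mulr1 -scalerAr => ->.
  rewrite !(coefB, coefD, coefZ, coefMn, coefXn); case: eqP => [ji|_].
    have -> : m = i by lia.
    by rewrite -mul2n natrM /=; ring.
  by rewrite mul0rn !mulr0 subr0.
- rewrite mulrN XX [t.2 * _]mulrC !(coefB, coefN, coefD, coefZ, coefMn, coefXnM, coefXM, coef_deriv).
  case: (ltnP j i) => ji; first by rewrite mul0rn !mulr0 !oppr0 mulr0 addr0.
  have [c2|c3] := leqP (j - i) 1; first by lia.
  have [c2'|c3'] := leqP (j - i) 2; last first.
    by rewrite !Q_coef ?mulr0 ?mul0rn ?oppr0 ?mulr0 ?addr0.
  have -> : m = i by lia.
  by rewrite -mul2n natrM; field.
Qed.

End Fits.

(** * The quotient as a table indexed by generators *)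

Section Quotient.

Variable K : numFieldType.

(** The generator of index k is f^i g^e with e = gen_odd k and i = gen_exp k; the
    odd generators start at x_3 = g. *)
Definition gen_odd n (k : 'I_n) : bool := odd (gen_index k).
Definition gen_exp n (k : 'I_n) : nat :=
  if gen_odd k then (gen_index k - 3)./2 else (gen_index k)./2.

Definition gen n (k : 'I_n) : pair_poly K := mon K (gen_odd k) (gen_exp k).

Lemma fits_gen m (k : 'I_m.*2) : fits (bound m) (gen k).
Proof.
apply: fits_mon; rewrite /bound /gen_odd /gen_exp /gen_odd /gen_index.
have := ltn_ord k; case: eqP => [->|/eqP k0] //= kn.
by case: ifP => /= odd_k; lia.
Qed.

Lemma sum_gen (V : nmodType) (G : bool -> nat -> V) m : (0 < m)%N ->
  \sum_(k < m.*2) G (gen_odd k) (gen_exp k) = \sum_(e : bool) \sum_(i < bound m e) G e i.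
Proof.
pose g i := G (odd i) (if odd i then (i - 3)./2 else i./2).
move=> m0; rewrite big_bool /=.
(* The generators have the indices 0, 2, 3, ..., n; the induction on m adds the
   last two of them. *)
transitivity (g 0%N + \sum_(2 <= j < m.*2.+1) g j).
  rewrite -(prednK m0) doubleS big_ord_recl; congr (_ + _).
  by rewrite big_add1 big_add1 /= big_mkord; apply: eq_bigr.
elim: m m0 => // -[|m] IHm _.
  by rewrite big_nat1 !(big_ord_recl, big_ord0) addr0 add0r.
rewrite [m.+2.*2]doubleS big_nat_recr // big_nat_recr // addrA addrA IHm //=.
rewrite [in RHS]big_ord_recr [X in _ = _ + X]big_ord_recr /= /g.
have -> : odd m.+1.*2.+1 = true by rewrite /= odd_double.
have -> : odd m.+1.*2.+2 = false by rewrite /= odd_double.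
have -> : ((m.+1.*2.+1 - 3)./2 = m)%N by lia.
have -> : (m.+1.*2.+2./2 = m.+2)%N by lia.
by rewrite -!addrA; congr (_ + _); rewrite addrCA.
Qed.

Definition quo n (t : param K) (u v : pair_poly K) (k l : 'I_n) : K :=
  divtab (numer n t u v (gen_odd k) (gen_odd l)) (gen_exp k) (gen_exp l).

Section Bilinear.

Variables (T : comNzRingType) (s : {rmorphism K -> T}).

Definition bilin (B : pair_poly K -> pair_poly K -> T) : Prop :=
  (forall c u u' v, B (c *: u + u') v = s c * B u v + B u' v) /\
  (forall c u v v', B u (c *: v + v') = s c * B u v + B u v').

Definition alt_form (B : pair_poly K -> pair_poly K -> T) u v := B u v - B v u.

Variable B : pair_poly K -> pair_poly K -> T.
Hypothesis Bbilin : bilin B.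

Lemma bilin_suml (I : Type) (r : seq I) (p : pred I) (c : I -> K) F v :
  B (\sum_(i <- r | p i) c i *: F i) v = \sum_(i <- r | p i) s (c i) * B (F i) v.
Proof.
elim/big_rec2: _ => [|i x y _ <-]; last by case: Bbilin => -> _.
have := Bbilin.1 (-1) 0 0 v.
by rewrite scaler0 addr0 rmorphN rmorph1 mulN1r addNr.
Qed.

Lemma bilin_sumr (I : Type) (r : seq I) (p : pred I) (c : I -> K) F u :
  B u (\sum_(i <- r | p i) c i *: F i) = \sum_(i <- r | p i) s (c i) * B u (F i).
Proof.
elim/big_rec2: _ => [|i x y _ <-]; last by case: Bbilin => _ ->.
have := Bbilin.2 (-1) u 0 0.
by rewrite scaler0 addr0 rmorphN rmorph1 mulN1r addNr.
Qed.

Lemma bilin_addl u u' v : B (u + u') v = B u v + B u' v.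
Proof. by case: Bbilin => H _; have := H 1 u u' v; rewrite scale1r rmorph1 mul1r. Qed.

Lemma bilin_addr u v v' : B u (v + v') = B u v + B u v'.
Proof. by case: Bbilin => _ H; have := H 1 u v v'; rewrite scale1r rmorph1 mul1r. Qed.

Lemma bilin_expand (L : bool -> nat) u v : fits L u -> fits L v ->
  B u v = \sum_(e : bool) \sum_(e' : bool) \sum_(i < L e) \sum_(j < L e')
    s ((coord e u)`_i * (coord e' v)`_j) * B (mon K e i) (mon K e' j).
Proof.
move=> Lu Lv; rewrite [in LHS](fits_expand Lu) [in LHS](fits_expand Lv).
transitivity (\sum_(e : bool) B (\sum_(i < L e) (coord e u)`_i *: mon K e i)
    (\sum_(e' : bool) \sum_(j < L e') (coord e' v)`_j *: mon K e' j)).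
  by rewrite !big_bool bilin_addl.
apply: eq_bigr => e _.
transitivity (\sum_(e' : bool) B (\sum_(i < L e) (coord e u)`_i *: mon K e i)
    (\sum_(j < L e') (coord e' v)`_j *: mon K e' j)).
  by rewrite !big_bool bilin_addr.
apply: eq_bigr => e' _; rewrite bilin_suml; apply: eq_bigr => i _.
rewrite bilin_sumr mulr_sumr; apply: eq_bigr => j _.
by rewrite rmorphM mulrA.
Qed.

Lemma alt_form_expand (L : bool -> nat) u v : fits L u -> fits L v ->
  alt_form B u v = \sum_(e : bool) \sum_(e' : bool) \sum_(i < L e) \sum_(j < L e')
    s (alt_coef u v e e' i j) * B (mon K e i) (mon K e' j).
Proof.
move=> Lu Lv; rewrite /alt_form (bilin_expand Lu Lv) (bilin_expand Lv Lu).
rewrite -sumrB; apply: eq_bigr => e _; rewrite -sumrB; apply: eq_bigr => e' _.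
rewrite -sumrB; apply: eq_bigr => i _; rewrite -sumrB; apply: eq_bigr => j _.
by rewrite rmorphB mulrBl.
Qed.

(** Division by f_1 - f_2, tested by a bilinear map B in place of the tensor
    product. Other choices of B than a product of two ring morphisms are used
    below to differentiate the quotient in one variable. *)
Lemma quo_mulP m (t : param K) u v : (0 < m)%N ->
  (size t.1.2 <= 5)%N -> (size t.2 <= 3)%N -> fits (bound m) u -> fits (bound m) v ->
  let n := m.*2 in
  \sum_(k < n) \sum_(l < n) s (quo t u v k l) *
    (B (mul_f (gen k)) (gen l) - B (gen k) (mul_f (gen l)))
  = alt_form B (euler n t u) v - alt_form B (euler n t v) u
  + alt_form B (mul_f u) (der t v) - alt_form B (mul_f v) (der t u).
Proof.
move=> m0 Ps Qs Lu Lv /=.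
have Eu := fits_euler m0 Ps Qs Lu; have Ev := fits_euler m0 Ps Qs Lv.
have Du := fits_der m0 Ps Qs Lu; have Dv := fits_der m0 Ps Qs Lv.
have Fu := fits_mul_f Lu; have Fv := fits_mul_f Lv.
have Cu := fits_boundS Lu; have Cv := fits_boundS Lv.
rewrite (alt_form_expand Eu Cv) (alt_form_expand Ev Cu) (alt_form_expand Fu Dv) (alt_form_expand Fv Du).
pose w e i e' j := divtab (numer m.*2 t u v e e') i j.
pose b e i e' j := B (mon K e i) (mon K e' j).
have mm e i : mul_f (mon K e i) = mon K e i.+1.
  by case: e; rewrite /mul_f /mon /= mulr0 exprS.
transitivity (\sum_(k < m.*2) \sum_(e' : bool) \sum_(j < bound m e')
    s (w (gen_odd k) (gen_exp k) e' j) * (b (gen_odd k) (gen_exp k).+1 e' j - b (gen_odd k) (gen_exp k) e' j.+1)).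
  apply: eq_bigr => k _; rewrite -[RHS](sum_gen (fun e' j => s (w (gen_odd k) (gen_exp k) e' j) *
    (b (gen_odd k) (gen_exp k).+1 e' j - b (gen_odd k) (gen_exp k) e' j.+1))) //.
  by apply: eq_bigr => l _; rewrite /gen !mm.
rewrite (sum_gen (fun e i => \sum_(e' : bool) \sum_(j < bound m e')
    s (w e i e' j) * (b e i.+1 e' j - b e i e' j.+1))) //.
rewrite -sumrB -big_split -sumrB; apply: eq_bigr => e _.
rewrite exchange_big -sumrB -big_split -sumrB; apply: eq_bigr => e' _.
have Z (x y : pair_poly K) i j : fits (boundS m) x -> fits (boundS m) y ->
    (bound m e < i)%N \/ (bound m e' < j)%N -> alt_coef x y e e' i j = 0.
  move=> Lx Ly [ij|ij]; first by rewrite /alt_coef [(coord e x)`_i]Lx // [(coord e y)`_i]Ly // !mul0r subr0.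
  by rewrite /alt_coef [(coord e' x)`_j]Lx // [(coord e' y)`_j]Ly // !mulr0 subr0.
have Zn i j : (bound m e < i)%N \/ (bound m e' < j)%N -> numer m.*2 t u v e e' i j = 0.
  by move=> ij; rewrite /numer !Z // !(subr0, addr0).
rewrite (sum_divtab (L := bound m e) (L' := bound m e') _ _ _ s (fun i j => b e i e' j)).
- rewrite -sumrB -big_split -sumrB; apply: eq_bigr => i _.
  rewrite -sumrB -big_split -sumrB; apply: eq_bigr => j _.
  by rewrite /numer /= !(rmorphB, rmorphD) !(mulrBl, mulrDl).
- by move=> c; exact: numer_diag.
- by move=> i j ij; apply: Zn; left.
- by move=> i j ij; apply: Zn; right.
Qed.

End Bilinear.

Lemma quo_sym m t u v (k l : 'I_m.*2) : quo t u v k l = quo t u v l k.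
Proof.
rewrite /quo (divtab_flip (@numer_diag K _ t u v _ _)) /divtab.
rewrite -sumrN; apply: eq_bigr => d _.
by rewrite -numer_swap numer_alt opprK.
Qed.

Lemma quo_alt n t u v (k l : 'I_n) : quo t v u k l = - quo t u v k l.
Proof. by rewrite /quo /divtab -sumrN; apply: eq_bigr => d _; exact: numer_alt. Qed.

End Quotient.

(** * Biderivations of polynomial rings *)

Section Biderivations.

Variables (K : fieldType) (n : nat).

Notation A := {mpoly K[n]}.

Definition is_derivation (d : A -> A) : Prop :=
  (forall c p q, d (c *: p + q) = c *: d p + d q) /\
  (forall p q, d (p * q) = p * d q + d p * q).

Lemma derivation_eq0 (d : A -> A) :
  is_derivation d -> (forall i, d 'X_i = 0) -> forall p, d p = 0.
Proof.
case=> dL dM dX.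
have d0 : d 0 = 0 by have := dL (-1) 0 0; rewrite scaler0 addr0 scaleN1r addNr.
have d1 : d 1 = 0.
  have := dM 1 1; rewrite !mulr1 mul1r => /eqP.
  by rewrite -subr_eq0 opprD addrA subrr sub0r oppr_eq0 => /eqP.
have dMz p q : d p = 0 -> d q = 0 -> d (p * q) = 0.
  by move=> dp dq; rewrite dM dp dq mulr0 mul0r addr0.
elim/mpolyind => // c m p _ _ dp; rewrite dL dp addr0 mpolyXE_id.
rewrite (_ : d _ = 0) ?scaler0 //.
elim/big_ind: _ => // i _; elim: (m i) => [|k IHk]; first by rewrite expr0.
by rewrite exprS; exact: dMz.
Qed.

Lemma biderivation_eq (B B' : bracket K n) :
  is_biderivation B -> is_biderivation B' ->
  (forall i j, B 'X_i 'X_j = B' 'X_i 'X_j) -> forall p q, B p q = B' p q.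
Proof.
move=> bB bB' E p q; apply/eqP; rewrite -subr_eq0; apply/eqP.
apply: (derivation_eq0 (d := fun p => B p q - B' p q)) => [|i].
  split=> [c p1 p2|p1 p2].
    rewrite (biderivation_linear_l bB) (biderivation_linear_l bB').
    by rewrite opprD addrACA -scalerBr.
  by rewrite (biderivation_leibniz_l bB) (biderivation_leibniz_l bB'); ring.
apply: (derivation_eq0 (d := fun q => B 'X_i q - B' 'X_i q)) => [|j].
  split=> [c p1 p2|p1 p2].
    rewrite (biderivation_linear_r bB) (biderivation_linear_r bB').
    by rewrite opprD addrACA -scalerBr.
  by rewrite (biderivation_leibniz_r bB) (biderivation_leibniz_r bB'); ring.
by rewrite E subrr.
Qed.

Lemma biderivation_suml (B : bracket K n) (I : Type) (r : seq I) (c : I -> K) F p :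
  is_biderivation B -> B (\sum_(i <- r) c i *: F i) p = \sum_(i <- r) c i *: B (F i) p.
Proof.
move=> bB; elim/big_rec2: _ => [|i x y _ <-]; last exact: (biderivation_linear_l bB).
by have := biderivation_linear_l bB (-1) 0 0 p; rewrite scaler0 addr0 scaleN1r addNr.
Qed.

Lemma biderivation_sumr (B : bracket K n) (I : Type) (r : seq I) (c : I -> K) F p :
  is_biderivation B -> B p (\sum_(i <- r) c i *: F i) = \sum_(i <- r) c i *: B p (F i).
Proof.
move=> bB; elim/big_rec2: _ => [|i x y _ <-]; last exact: (biderivation_linear_r bB).
by have := biderivation_linear_r bB (-1) 0 0 p; rewrite scaler0 addr0 scaleN1r addNr.
Qed.

Definition jacobiator (B : bracket K n) p q r := B p (B q r) + B q (B r p) + B r (B p q).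

(** For an antisymmetric biderivation the jacobiator is a derivation in each
    argument: the terms in which both factors of a product are differentiated
    cancel in pairs. So it is enough to test it on generators. *)
Lemma poisson_of_gens (B : bracket K n) : is_biderivation B ->
  (forall i j, B 'X_i 'X_j = - B 'X_j 'X_i) ->
  (forall i j k, jacobiator B 'X_i 'X_j 'X_k = 0) -> is_poisson B.
Proof.
move=> bB anti jac.
have [Ll Lr Ml Mr] := bB.
have antiB p q : B p q = - B q p.
  apply: (biderivation_eq (B' := fun p q => - B q p)) => // {p q}; split.
  - by move=> c p q r; rewrite Lr opprD scalerN.
  - by move=> c p q r; rewrite Ll opprD scalerN.
  - by move=> p q r; rewrite Mr; ring.
  - by move=> p q r; rewrite Ml; ring.
have jder q r : is_derivation (fun p => jacobiator B p q r).
  split=> [c p1 p2|p1 p2]; rewrite /jacobiator.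
    by rewrite !(Ll, Lr) -!mul_mpolyC; ring.
  have DB s u v : B s (u + v) = B s u + B s v.
    by have := Lr 1 u v s; rewrite !scale1r.
  rewrite !(Ml, Mr) !DB !(Ml, Mr) [B q p1]antiB [B q p2]antiB [B r p1]antiB [B r p2]antiB.
  rewrite [B p1 q]antiB [B p2 q]antiB; ring.
have jcyc p q r : jacobiator B p q r = jacobiator B q r p.
  by rewrite /jacobiator -addrA addrC.
split=> // p q r; rewrite -/(jacobiator B p q r).
apply: (derivation_eq0 (jder q r)) => i; rewrite jcyc.
apply: (derivation_eq0 (jder r 'X_i)) => j; rewrite jcyc.
by apply: (derivation_eq0 (jder 'X_i 'X_j)) => k; rewrite jcyc.
Qed.

Lemma poissonZ (B B' : bracket K n) c : is_poisson B ->
  (forall p q, B' p q = c *: B p q) -> is_poisson B'.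
Proof.
move=> [[Ll Lr Ml Mr] anti jac] E; split; first split.
- by move=> a p q r; rewrite !E Ll scalerDr !scalerA mulrC.
- by move=> a p q r; rewrite !E Lr scalerDr !scalerA mulrC.
- by move=> p q r; rewrite !E Ml -!mul_mpolyC; ring.
- by move=> p q r; rewrite !E Mr -!mul_mpolyC; ring.
- by move=> p q; rewrite !E anti scalerN.
have BZ p q : B p (c *: q) = c *: B p q.
  have B0 : B p 0 = 0 by have := Lr (-1) 0 0 p; rewrite scaler0 addr0 scaleN1r addNr.
  by have := Lr c q 0 p; rewrite B0 !addr0.
by move=> p q r; rewrite !E !BZ -!scalerDr jac !scaler0.
Qed.

Definition tab_bracket (c : 'I_n -> 'I_n -> A) : bracket K n :=
  fun p q => \sum_(k < n) \sum_(l < n) c k l * (p^`M(k) * q^`M(l)).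

Lemma tab_biderivation c : is_biderivation (tab_bracket c).
Proof.
split=> [a p q r|a p q r|p q r|p q r]; rewrite /tab_bracket.
- rewrite scaler_sumr -big_split; apply: eq_bigr => k _ /=.
  rewrite scaler_sumr -big_split; apply: eq_bigr => l _ /=.
  by rewrite mderivD mderivZ -!mul_mpolyC; ring.
- rewrite scaler_sumr -big_split; apply: eq_bigr => k _ /=.
  rewrite scaler_sumr -big_split; apply: eq_bigr => l _ /=.
  by rewrite mderivD mderivZ -!mul_mpolyC; ring.
- rewrite mulr_sumr mulr_suml -big_split; apply: eq_bigr => k _ /=.
  rewrite mulr_sumr mulr_suml -big_split; apply: eq_bigr => l _ /=.
  by rewrite mderivM; ring.
- rewrite mulr_sumr mulr_suml -big_split; apply: eq_bigr => k _ /=.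
  rewrite mulr_sumr mulr_suml -big_split; apply: eq_bigr => l _ /=.
  by rewrite mderivM; ring.
Qed.

Lemma mderivXi (i k : 'I_n) : ('X_i : A)^`M(k) = (i == k)%:R.
Proof.
rewrite mderivX mnm1E; case: eqVneq => [->|_]; last by rewrite scale0r.
by rewrite scale1r -{1}[U_(k)%MM]add0m addmK mpolyX0.
Qed.

Lemma sum_delta (R : comNzRingType) (F : 'I_n -> R) j : \sum_(k < n) F k * (j == k)%:R = F j.
Proof.
rewrite (bigD1 j) //= eqxx mulr1 big1 ?addr0 // => k kj.
by rewrite eq_sym (negPf kj) mulr0.
Qed.

Lemma tab_bracketXr c p j : tab_bracket c p 'X_j = \sum_(k < n) c k j * p^`M(k).
Proof.
apply: eq_bigr => k _; rewrite -[RHS](sum_delta (fun l => c k l * p^`M(k))).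
by apply: eq_bigr => l _; rewrite mderivXi mulrA.
Qed.

Lemma tab_bracketX c i j : tab_bracket c 'X_i 'X_j = c i j.
Proof.
rewrite tab_bracketXr -[RHS](sum_delta (fun k => c k j)).
by apply: eq_bigr => k _; rewrite mderivXi.
Qed.

End Biderivations.

(** * Brackets given by quadratic forms *)

Section QuadraticBracket.

Variables (K : numFieldType) (n : nat).
Notation A := {mpoly K[n]}.

(** The jacobiator of x E + B is J(E) x^2 + M x + J(B) for some M. If it vanishes
    for x = 1 and x = -1 and J(E) = 0, adding the two values gives J(B) = 0. *)
Lemma poisson_limit (B E B1 B2 : bracket K n) :
  is_biderivation B -> is_poisson E -> is_poisson B1 -> is_poisson B2 ->
  (forall p q, B1 p q = E p q + B p q) -> (forall p q, B2 p q = - E p q + B p q) ->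
  is_poisson B.
Proof.
move=> bB [bE eAnti eJac] [_ pAnti pJac] [_ _ nJac] E1 E2.
split=> // [p q|p q r].
  by have := pAnti p q; rewrite !E1 eAnti opprD; exact: addrI.
have addB a u v : B a (u + v) = B a u + B a v.
  by have := biderivation_linear_r bB 1 u v a; rewrite !scale1r.
have addE a u v : E a (u + v) = E a u + E a v.
  by have := biderivation_linear_r bE 1 u v a; rewrite !scale1r.
have subB a u v : B a (- u + v) = - B a u + B a v.
  by have := biderivation_linear_r bB (-1) u v a; rewrite !scaleN1r.
have subE a u v : E a (- u + v) = - E a u + E a v.
  by have := biderivation_linear_r bE (-1) u v a; rewrite !scaleN1r.
move: (eJac p q r) (pJac p q r) (nJac p q r).
rewrite !E1 !E2 !subE !subB !addE !addB => e0 p0 n0.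
apply: (scalerI (a := 2)); first by rewrite pnatr_eq0.
rewrite scaler0 -mul_mpolyC -[RHS](addr0 0) -{1}p0 -n0.
rewrite -[LHS]addr0 -[X in _ + X = _](mulr0 2) -e0; ring.
Qed.

(** The factor 1/2 makes the table w the table of coefficients of the symmetric
    tensor that represents the form, as x_k x_l stands for x_k (x) x_l + x_l (x) x_k. *)
Definition qform (w : 'I_n -> 'I_n -> K) : A :=
  \sum_(k < n) \sum_(l < n) (2^-1 * w k l) *: ('X_k * 'X_l).

Lemma qform_homog w : qform w \is 2.-homog.
Proof.
apply: rpred_sum => k _; apply: rpred_sum => l _; apply: rpredZ.
by rewrite -mpolyXD dhomogX /= mdegD !mdeg1.
Qed.

Variable w : 'I_n -> 'I_n -> 'I_n -> 'I_n -> K.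

Definition quad_tab (i j : 'I_n) : A := qform (w i j).

Definition quad_bracket : bracket K n := tab_bracket quad_tab.

Hypothesis w_sym : forall i j k l, w i j k l = w i j l k.

(** By the Leibniz rule and the symmetry of the inner form, an iterated bracket
    is a cubic form whose table is a contraction of two quadratic tables. *)
Lemma quad_bracket_iter a b c :
  quad_bracket 'X_a (quad_bracket 'X_b 'X_c)
  = \sum_(p < n) \sum_(q < n) \sum_(l < n)
      (2^-1 * \sum_(k < n) w a k p q * w b c k l) *: ('X_p * 'X_q * 'X_l).
Proof.
have bB := tab_biderivation quad_tab.
have dbl : 2^-1 + 2^-1 = 1 :> K by field.
transitivity (\sum_(k < n) \sum_(l < n) w b c k l *: (quad_tab a k * 'X_l)).
  rewrite /quad_bracket tab_bracketX [in LHS]/quad_tab [in LHS]/qform.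
  transitivity (\sum_(k < n) \sum_(l < n) (2^-1 * w b c k l) *:
      tab_bracket quad_tab 'X_a ('X_k * 'X_l)).
    rewrite (eq_bigr (fun k => 1 *: \sum_(l < n) (2^-1 * w b c k l) *: ('X_k * 'X_l))).
      rewrite biderivation_sumr //; apply: eq_bigr => k _.
      by rewrite scale1r biderivation_sumr.
    by move=> k _; rewrite scale1r.
  transitivity (\sum_(k < n) \sum_(l < n) (2^-1 * w b c k l) *: (quad_tab a k * 'X_l)
      + \sum_(k < n) \sum_(l < n) (2^-1 * w b c k l) *: ('X_k * quad_tab a l)).
    rewrite -big_split; apply: eq_bigr => k _.
    rewrite -big_split; apply: eq_bigr => l _ /=.
    by rewrite (biderivation_leibniz_r bB) !tab_bracketX scalerDr addrC.
  rewrite [X in _ + X = _]exchange_big -big_split; apply: eq_bigr => k _ /=.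
  rewrite -big_split; apply: eq_bigr => l _ /=.
  rewrite [w b c l k]w_sym ['X_l * _]mulrC -scalerDl -mulrDl dbl.
  by rewrite mul1r.
transitivity (\sum_(k < n) \sum_(p < n) \sum_(q < n) \sum_(l < n)
    (2^-1 * (w a k p q * w b c k l)) *: ('X_p * 'X_q * 'X_l : A)).
  apply: eq_bigr => k _.
  transitivity (\sum_(l < n) \sum_(p < n) \sum_(q < n)
      (2^-1 * (w a k p q * w b c k l)) *: ('X_p * 'X_q * 'X_l : A)).
    apply: eq_bigr => l _.
    rewrite /quad_tab /qform mulr_suml scaler_sumr; apply: eq_bigr => p _.
    rewrite mulr_suml scaler_sumr; apply: eq_bigr => q _.
    by rewrite -scalerAl scalerA; congr (_ *: _); ring.
  by rewrite exchange_big; apply: eq_bigr => p _; rewrite exchange_big.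
rewrite exchange_big; apply: eq_bigr => p _; rewrite exchange_big; apply: eq_bigr => q _.
rewrite exchange_big; apply: eq_bigr => l _.
by rewrite -scaler_suml mulr_sumr.
Qed.

Lemma sum_cyc (V : nmodType) (F : 'I_n -> 'I_n -> 'I_n -> V) :
  \sum_(p < n) \sum_(q < n) \sum_(l < n) F q l p = \sum_(p < n) \sum_(q < n) \sum_(l < n) F p q l.
Proof.
rewrite [RHS]exchange_big; under [RHS]eq_bigr => p _ do rewrite exchange_big.
by rewrite [RHS]exchange_big; under [RHS]eq_bigr => p _ do rewrite exchange_big.
Qed.

(** The cubic monomial does not change under cyclic permutations of its indices,
    so three times the form has the cyclic sums of S as coefficients. *)
Lemma cubic_eq0 (S : 'I_n -> 'I_n -> 'I_n -> K) :
  (forall p q l, S p q l + S q l p + S l p q = 0) ->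
  \sum_(p < n) \sum_(q < n) \sum_(l < n) S p q l *: ('X_p * 'X_q * 'X_l : A) = 0.
Proof.
move=> S0; pose F p q l : A := S p q l *: ('X_p * 'X_q * 'X_l).
pose x := \sum_(p < n) \sum_(q < n) \sum_(l < n) F p q l; rewrite -/x.
have x2 : \sum_(p < n) \sum_(q < n) \sum_(l < n) F q l p = x by exact: sum_cyc.
have x3 : \sum_(p < n) \sum_(q < n) \sum_(l < n) F l p q = x.
  by rewrite -x2 -(sum_cyc (fun p q l => F q l p)).
have : x + x + x = 0.
  rewrite -{2}x2 -{2}x3 -!big_split; apply: big1 => p _.
  rewrite -!big_split; apply: big1 => q _; rewrite -!big_split; apply: big1 => l _ /=.
  rewrite /F; have -> : 'X_q * 'X_l * 'X_p = 'X_p * 'X_q * 'X_l :> A by ring.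
  have -> : 'X_l * 'X_p * 'X_q = 'X_p * 'X_q * 'X_l :> A by ring.
  by rewrite -!scalerDl S0 scale0r.
have -> : x + x + x = 3 *: x by rewrite -mul_mpolyC; ring.
by move/eqP; rewrite scaler_eq0 pnatr_eq0 /= => /eqP.
Qed.

Lemma quad_jacobi a b c :
  (forall p q l, let S p q l := \sum_(k < n) (w a k p q * w b c k l
       + w b k p q * w c a k l + w c k p q * w a b k l) in
     S p q l + S q l p + S l p q = 0) ->
  jacobiator quad_bracket 'X_a 'X_b 'X_c = 0.
Proof.
move=> S0; rewrite /jacobiator !quad_bracket_iter -!big_split /=.
rewrite -[RHS](cubic_eq0 (S := fun p q l => 2^-1 * \sum_(k < n) (w a k p q * w b c k l
       + w b k p q * w c a k l + w c k p q * w a b k l))); last first.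
  by move=> p q l; rewrite -!mulrDr S0 mulr0.
apply: eq_bigr => p _; rewrite -!big_split; apply: eq_bigr => q _.
rewrite -!big_split; apply: eq_bigr => l _ /=.
by rewrite -!scalerDl -!mulrDr -!big_split.
Qed.

End QuadraticBracket.

(** * The identity behind the Jacobi identity *)

Section RingIdentities.

Variable T : comNzRingType.

(** The value of the bracket of u and v at a pair of points b, c, in terms of the
    values of u, v and of their derivatives there. *)
Definition bracket_val (n lambda ub ub' uc uc' vb vb' vc vc' : T) : T :=
  n * lambda * (ub * vc - vb * uc) + ub * vc' + uc * vb' - vb * uc' - vc * ub'.

(** The derivative of bracket_val in the point b alone, where Dlambda is the
    derivative of lambda in that point. *)
Definition bracket_der (n lambda Dlambda ub ub' ub'' uc uc' vb vb' vb'' vc vc' : T) : T :=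
  n * Dlambda * (ub * vc - vb * uc) + n * lambda * (ub' * vc - vb' * uc)
  + ub' * vc' + uc * vb'' - vb' * uc' - vc * ub''.

(** The operator A_ab = n lambda_ab a - a' + a D_b applied to the bracket of u and
    v at the points b and c. *)
Definition jterm (n lam_ab lam_bc lam'_bc : T) (a a' : T) ub ub' ub'' uc uc' vb vb' vb'' vc vc' :=
  (n * lam_ab * a - a') * bracket_val n lam_bc ub ub' uc uc' vb vb' vc vc'
  + a * bracket_der n lam_bc lam'_bc ub ub' ub'' uc uc' vb vb' vb'' vc vc'.

(** The value at the points 1, 2, 3 of the bracket of a with the bracket of u and
    v, one term for each order of the points; m_ij is the derivative of lambda_ij
    in the point i, and lambda_ji = - lambda_ij. *)
Definition jsum (n L12 L13 L23 m12 m13 m23 m21 m31 m32 : T)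
  a1 a2 a3 a1' a2' a3' u1 u2 u3 u1' u2' u3' u1'' u2'' u3'' v1 v2 v3 v1' v2' v3' v1'' v2'' v3'' :=
  jterm n L12 L23 m23 a1 a1' u2 u2' u2'' u3 u3' v2 v2' v2'' v3 v3'
  + jterm n L13 (- L23) m32 a1 a1' u3 u3' u3'' u2 u2' v3 v3' v3'' v2 v2'
  + jterm n (- L12) L13 m13 a2 a2' u1 u1' u1'' u3 u3' v1 v1' v1'' v3 v3'
  + jterm n L23 (- L13) m31 a2 a2' u3 u3' u3'' u1 u1' v3 v3' v3'' v1 v1'
  + jterm n (- L13) L12 m12 a3 a3' u1 u1' u1'' u2 u2' v1 v1' v1'' v2 v2'
  + jterm n (- L23) (- L12) m21 a3 a3' u2 u2' u2'' u1 u1' v2 v2' v2'' v1 v1'.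

(** The derivatives of lambda occur only in the differences m_12 - m_21,
    m_23 - m_32 and m_31 - m_13, each multiplied by n times the determinant of the
    values of a, u, v at the three points, and h1 - h2, h2 - h3, h3 - h1 add up to
    zero. Everything else cancels identically. *)
Lemma jsum_cyc (n L12 L13 L23 m12 m13 m23 m21 m31 m32 h1 h2 h3 : T)
  a1 a2 a3 a1' a2' a3' a1'' a2'' a3''
  u1 u2 u3 u1' u2' u3' u1'' u2'' u3'' v1 v2 v3 v1' v2' v3' v1'' v2'' v3'' :
  m12 = m21 + (h1 - h2) -> m13 = m31 + (h1 - h3) -> m23 = m32 + (h2 - h3) ->
  jsum n L12 L13 L23 m12 m13 m23 m21 m31 m32 a1 a2 a3 a1' a2' a3'
    u1 u2 u3 u1' u2' u3' u1'' u2'' u3'' v1 v2 v3 v1' v2' v3' v1'' v2'' v3''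
  + jsum n L12 L13 L23 m12 m13 m23 m21 m31 m32 u1 u2 u3 u1' u2' u3'
    v1 v2 v3 v1' v2' v3' v1'' v2'' v3'' a1 a2 a3 a1' a2' a3' a1'' a2'' a3''
  + jsum n L12 L13 L23 m12 m13 m23 m21 m31 m32 v1 v2 v3 v1' v2' v3'
    a1 a2 a3 a1' a2' a3' a1'' a2'' a3'' u1 u2 u3 u1' u2' u3' u1'' u2'' u3'' = 0.
Proof.
move=> -> -> ->; rewrite /jsum /jterm /bracket_val /bracket_der.
ring.
Qed.

End RingIdentities.

(** * Evaluation at points of the curve *)

Section Points.

Variables (K : numFieldType) (T : comNzRingType) (s : {rmorphism K -> T}).

Definition evalp (f : T) (p : {poly K}) : T := (map_poly s p).[f].

Lemma evalpD f p q : evalp f (p + q) = evalp f p + evalp f q.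
Proof. by rewrite /evalp rmorphD hornerD. Qed.
Lemma evalpM f p q : evalp f (p * q) = evalp f p * evalp f q.
Proof. by rewrite /evalp rmorphM hornerM. Qed.
Lemma evalpZ f c p : evalp f (c *: p) = s c * evalp f p.
Proof. by rewrite /evalp map_polyZ hornerZ. Qed.
Lemma evalpN f p : evalp f (- p) = - evalp f p.
Proof. by rewrite /evalp rmorphN hornerN. Qed.
Lemma evalpX f : evalp f 'X = f.
Proof. by rewrite /evalp map_polyX hornerX. Qed.
Definition evalpE := (evalpD, evalpM, evalpZ, evalpN, evalpX).

Definition eval (f g : T) (h : pair_poly K) : T := evalp f h.1 + evalp f h.2 * g.

Lemma evalP f g c u v : eval f g (c *: u + v) = s c * eval f g u + eval f g v.
Proof. by rewrite /eval /= !evalpE; ring. Qed.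

Lemma evalD f g u v : eval f g (u + v) = eval f g u + eval f g v.
Proof. by rewrite /eval /= !evalpE; ring. Qed.

Lemma evalB f g u v : eval f g (u - v) = eval f g u - eval f g v.
Proof. by rewrite /eval /= !evalpE; ring. Qed.

Lemma evalZ f g c u : eval f g (c *: u) = s c * eval f g u.
Proof. by rewrite /eval /= !evalpE; ring. Qed.

Lemma eval_mul_f f g h : eval f g (mul_f h) = f * eval f g h.
Proof. by rewrite /eval /= !evalpE; ring. Qed.

Variable t : param K.

Definition on_curve (f g : T) : Prop := g ^+ 2 = evalp f t.1.2 + evalp f t.2 * g.

Definition yval (f g : T) : T := g - s 2^-1 * evalp f t.2.

(** The polynomial R with y^2 = R(f). *)
Definition disc : {poly K} := t.1.2 + 4^-1 *: t.2 ^+ 2.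

Lemma half2 : s 2^-1 * 2 = 1.
Proof. by rewrite -(rmorph_nat s 2) -rmorphM mulVf ?pnatr_eq0 // rmorph1. Qed.

Hypothesis t1 : t.1.1 = 1.

Lemma eval_mul_y f g h : on_curve f g -> eval f g (mul_y t h) = yval f g * eval f g h.
Proof.
move=> fg; rewrite /eval /yval /= t1 !evalpE rmorph1.
have -> : (g - s 2^-1 * evalp f t.2) * (evalp f h.1 + evalp f h.2 * g)
   = evalp f h.1 * g + evalp f h.2 * g ^+ 2 - s 2^-1 * evalp f t.2 * (evalp f h.1 + evalp f h.2 * g).
  ring.
rewrite fg; apply/eqP; rewrite -subr_eq0; apply/eqP.
transitivity ((s 2^-1 * 2 - 1) * (evalp f t.2 * evalp f h.2 * g)); first by ring.
by rewrite half2 subrr mul0r.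
Qed.

Lemma yval2 f g : on_curve f g -> yval f g ^+ 2 = evalp f disc.
Proof.
move=> fg; rewrite /yval /disc [t.2 ^+ 2]expr2 !evalpE [LHS]expr2.
have -> : s 4^-1 = s 2^-1 ^+ 2.
  by rewrite -rmorphXn exprVn -natrX.
have -> : (g - s 2^-1 * evalp f t.2) * (g - s 2^-1 * evalp f t.2)
  = g ^+ 2 - (s 2^-1 * 2) * evalp f t.2 * g + s 2^-1 ^+ 2 * (evalp f t.2 * evalp f t.2) by ring.
by rewrite fg half2; ring.
Qed.

(** The Leibniz rule for D with D f = 2 y. *)
Lemma der_mul_f h : der t (mul_f h) = mul_f (der t h) + 2 *: mul_y t h.
Proof.
have -> : 2 *: mul_y t h = (2 *: (t.1.2 * h.2) - t.2 * h.1, 2 *: h.1 + t.2 * h.2).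
  by rewrite /mul_y t1; congr pair;
    rewrite /= ?scale1r ?scalerBr ?scalerDr scalerA mulfV ?pnatr_eq0 // scale1r.
rewrite /der /mul_f /= t1; congr pair; rewrite /= !derivM !derivX -!mul_polyC ?polyCM.
  ring.
ring.
Qed.

Lemma eval_der_mul_f f g h : on_curve f g ->
  eval f g (der t (mul_f h)) = f * eval f g (der t h) + 2 * yval f g * eval f g h.
Proof.
by move=> fg; rewrite der_mul_f evalD evalZ eval_mul_f eval_mul_y // rmorph_nat; ring.
Qed.

Lemma deriv_disc : disc^`() = t.1.2^`() + 2^-1 *: (t.2 * t.2^`()).
Proof.
rewrite /disc expr2 derivD derivZ derivM [_^`() * _]mulrC -mulr2n -scaler_nat scalerA.
by congr (_ + _ *: _); field.
Qed.

(** The Leibniz rule for D with D y = R'(f). *)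
Lemma der_mul_y h : der t (mul_y t h)
  = mul_y t (der t h) + (disc^`() * h.1, disc^`() * h.2).
Proof.
have h2 : 2 * (2^-1)%:P - 1 = 0 :> {poly K}.
  by rewrite -polyC_natr -polyCM mulfV ?pnatr_eq0 // subrr.
rewrite deriv_disc /der /mul_y /= t1 mulr1; congr pair; apply/eqP; rewrite -subr_eq0; apply/eqP;
  rewrite /= !(derivB, derivD, derivM, derivZ, derivX) -!mul_polyC ?polyCM ?mul1r.
- transitivity ((2 * (2^-1)%:P - 1) * (t.1.2 * t.2^`() * h.2
    + 2 * t.1.2 * t.2 * h.2^`() + t.2 * h.2 * t.1.2^`())); first by ring.
  by rewrite h2 mul0r.
transitivity (- (2 * (2^-1)%:P - 1) * (t.2^`() * h.1 + 2 * t.2 * h.1^`())); first by ring.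
by rewrite h2 oppr0 mul0r.
Qed.

Lemma eval_der_mul_y f g h : on_curve f g ->
  eval f g (der t (mul_y t h)) = yval f g * eval f g (der t h) + evalp f disc^`() * eval f g h.
Proof.
move=> fg; rewrite der_mul_y evalD eval_mul_y //; congr (_ + _).
by rewrite /eval /= !evalpE mulrDr mulrA.
Qed.

End Points.

(** * The bracket at two points *)

Section TwoPoints.

Variables (K : numFieldType) (T : comNzRingType) (s : {rmorphism K -> T}).

Variables (m : nat) (t : param K).
Hypothesis m_gt0 : (0 < m)%N.
Hypothesis t1 : t.1.1 = 1.
Hypothesis P_size : (size t.1.2 <= 5)%N.
Hypothesis Q_size : (size t.2 <= 3)%N.

Notation n := m.*2.

Lemma eval_euler (f g : T) (h : pair_poly K) : on_curve s t f g ->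
  eval s f g (euler n t h) = n%:R * (yval s t f g * eval s f g h) - f * eval s f g (der t h).
Proof. by move=> fg; rewrite /euler evalB evalZ eval_mul_y // eval_mul_f rmorph_nat. Qed.

Lemma eval_der_euler (f g : T) (h : pair_poly K) : on_curve s t f g ->
  eval s f g (der t (euler n t h))
  = n%:R * (yval s t f g * eval s f g (der t h) + evalp s f (disc t)^`() * eval s f g h)
    - (f * eval s f g (der t (der t h)) + 2 * yval s t f g * eval s f g (der t h)).
Proof.
move=> fg; have -> : der t (euler n t h) = n%:R *: der t (mul_y t h) - der t (mul_f (der t h)).
  rewrite /euler derP; congr (_ + _); rewrite /der; congr pair;
    rewrite /= !derivN -!mul_polyC; ring.
by rewrite evalB evalZ eval_der_mul_y // eval_der_mul_f // rmorph_nat.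
Qed.

(** The element lambda at the pair of points p, q, where d is the inverse of the
    difference of their f-coordinates. *)
Definition lambda (p q : T * T) (d : T) : T :=
  (yval s t p.1 p.2 + yval s t q.1 q.2) * d.

(** The derivative of lambda in the point p, by D y = R'(f) and D f = 2 y. *)
Definition Dlambda (p q : T * T) (d : T) : T :=
  d * (evalp s p.1 (disc t)^`() - 2 * yval s t p.1 p.2 * lambda p q d).

Variables p q : T * T.
Hypothesis p_on : on_curve s t p.1 p.2.
Hypothesis q_on : on_curve s t q.1 q.2.

Notation e1 := (eval s p.1 p.2).
Notation e2 := (eval s q.1 q.2).
Notation D := (der t).

Lemma quo_eval_mul u v : fits (bound m) u -> fits (bound m) v ->
  (p.1 - q.1) * \sum_(k < n) \sum_(l < n) s (quo t u v k l) * (e1 (gen K k) * e2 (gen K l))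
  = n%:R * (yval s t p.1 p.2 + yval s t q.1 q.2) * (e1 u * e2 v - e1 v * e2 u)
  + (p.1 - q.1) * (e1 u * e2 (D v) + e2 u * e1 (D v) - e1 v * e2 (D u) - e2 v * e1 (D u)).
Proof.
move=> Lu Lv; pose B x y := e1 x * e2 y.
have Bb : bilin s B.
  by split=> [c x x' y|c x y y']; rewrite /B evalP; ring.
have := quo_mulP Bb m_gt0 P_size Q_size Lu Lv.
rewrite /alt_form /B /= !eval_euler // !eval_mul_f => E; rewrite mulr_sumr.
transitivity (\sum_(k < n) \sum_(l < n) s (quo t u v k l) *
    (e1 (mul_f (gen K k)) * e2 (gen K l) - e1 (gen K k) * e2 (mul_f (gen K l)))).
  apply: eq_bigr => k _; rewrite mulr_sumr; apply: eq_bigr => l _.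
  by rewrite !eval_mul_f; ring.
rewrite E; ring.
Qed.

Variable d : T.
Hypothesis dP : d * (p.1 - q.1) = 1.

Let lambdaE : yval s t p.1 p.2 = lambda p q d * (p.1 - q.1) - yval s t q.1 q.2.
Proof. by rewrite /lambda -mulrA dP mulr1 addrK. Qed.

Let DlambdaE : evalp s p.1 (disc t)^`()
  = Dlambda p q d * (p.1 - q.1) + 2 * yval s t p.1 p.2 * lambda p q d.
Proof. by rewrite /Dlambda mulrC mulrA [_ * d]mulrC dP mul1r subrK. Qed.

Let cancel (x y : T) : (p.1 - q.1) * x = (p.1 - q.1) * y -> x = y.
Proof. by move=> E; rewrite -[x]mul1r -[y]mul1r -dP -!mulrA E. Qed.

Lemma quo_eval u v : fits (bound m) u -> fits (bound m) v ->
  \sum_(k < n) \sum_(l < n) s (quo t u v k l) * (e1 (gen K k) * e2 (gen K l))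
  = bracket_val n%:R (lambda p q d) (e1 u) (e1 (D u)) (e2 u) (e2 (D u))
      (e1 v) (e1 (D v)) (e2 v) (e2 (D v)).
Proof.
by move=> Lu Lv; apply: cancel; rewrite quo_eval_mul // /bracket_val lambdaE; ring.
Qed.

(** Taking the bilinear map (D u)(p) v(q) in the division lemma differentiates the
    relation (f_1 - f_2) W = N in the first variable; since D f = 2 y this reads
    (f_1 - f_2) D_1 W + 2 y_1 W = D_1 N, which determines D_1 W. *)
Lemma quo_eval_der u v : fits (bound m) u -> fits (bound m) v ->
  \sum_(k < n) \sum_(l < n) s (quo t u v k l) * (e1 (D (gen K k)) * e2 (gen K l))
  = bracket_der n%:R (lambda p q d) (Dlambda p q d) (e1 u) (e1 (D u)) (e1 (D (D u))) (e2 u) (e2 (D u))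
      (e1 v) (e1 (D v)) (e1 (D (D v))) (e2 v) (e2 (D v)).
Proof.
move=> Lu Lv; pose B x y := e1 (D x) * e2 y.
have Bb : bilin s B.
  by split=> [c x x' y|c x y y']; rewrite /B ?derP evalP; ring.
have := quo_mulP Bb m_gt0 P_size Q_size Lu Lv.
rewrite /alt_form /B (eval_der_euler u p_on) (eval_der_euler v p_on).
rewrite (eval_euler u q_on) (eval_euler v q_on).
rewrite (eval_der_mul_f t1 u p_on) (eval_der_mul_f t1 v p_on).
rewrite (eval_mul_f s q.1 q.2 u) (eval_mul_f s q.1 q.2 v) => E.
apply: cancel; rewrite mulr_sumr.
transitivity (\sum_(k < n) \sum_(l < n) s (quo t u v k l) *
    (e1 (D (mul_f (gen K k))) * e2 (gen K l) - e1 (D (gen K k)) * e2 (mul_f (gen K l)))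
  - 2 * yval s t p.1 p.2 * \sum_(k < n) \sum_(l < n) s (quo t u v k l) * (e1 (gen K k) * e2 (gen K l))).
  rewrite mulr_sumr -sumrB; apply: eq_bigr => k _; rewrite !mulr_sumr -sumrB; apply: eq_bigr => l _.
  by rewrite eval_mul_f eval_der_mul_f //; ring.
rewrite E quo_eval // /bracket_val /bracket_der DlambdaE lambdaE; ring.
Qed.

Definition hval (f : T) : T := s (disc t)`_3 * f + 2 * s (disc t)`_4 * f ^+ 2.

Lemma disc_size : (size (disc t) <= 5)%N.
Proof.
rewrite /disc (leq_trans (size_polyD _ _)) // geq_max P_size /=.
rewrite (leq_trans (size_scale_leq _ _)) // expr2 (leq_trans (size_polyMleq _ _)) //.
by move: Q_size; clear; case: (size t.2) => [|[|[|[|?]]]].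
Qed.

Lemma evalp_disc f : evalp s f (disc t) = \sum_(i < 5) s (disc t)`_i * f ^+ i.
Proof.
rewrite /evalp (horner_coef_wide _ (n := 5)); last first.
  exact: leq_trans (size_poly _ _) disc_size.
by apply: eq_bigr => i _; rewrite coef_map.
Qed.

Lemma evalp_deriv_disc f : evalp s f (disc t)^`() = \sum_(i < 4) s (disc t)`_i.+1 * f ^+ i *+ i.+1.
Proof.
rewrite /evalp (horner_coef_wide _ (n := 4)); last first.
  apply: leq_trans (size_poly _ _) _; apply: leq_trans (size_poly _ _) _.
  by move: disc_size; case: (size _).
by apply: eq_bigr => i _; rewrite coef_map coef_deriv raddfMn mulrnAl.
Qed.

(** Multiplied by (f_p - f_q)^2, the left side minus the first term on the right
    is (R'(f_p) + R'(f_q)) (f_p - f_q) - 2 (R(f_p) - R(f_q)). For R of degree at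
    most two this vanishes, and f^3 and f^4 contribute (f_p - f_q)^3 and
    2 (f_p + f_q) (f_p - f_q)^3. Reversing the pair changes the sign
    of the inverse d. *)
Lemma Dlambda_sub : Dlambda p q d = Dlambda q p (- d) + (hval p.1 - hval q.1).
Proof.
apply/eqP; rewrite addrC -subr_eq; apply/eqP.
have -> : Dlambda p q d - Dlambda q p (- d) = d * (evalp s p.1 (disc t)^`() + evalp s q.1 (disc t)^`())
    - 2 * d ^+ 2 * (yval s t p.1 p.2 ^+ 2 - yval s t q.1 q.2 ^+ 2).
  by rewrite /Dlambda /lambda; ring.
rewrite !yval2 // !evalp_disc !evalp_deriv_disc !big_ord_recl !big_ord0 /= /bump /= !add1n /hval.
(* Two factors f_p - f_q absorb d and d ^+ 2 and leave a polynomial identity. *)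
apply: cancel; apply: cancel.
have -> : forall x y, (p.1 - q.1) * ((p.1 - q.1) * (d * x - 2 * d ^+ 2 * y))
   = d * (p.1 - q.1) * (p.1 - q.1) * x - 2 * (d * (p.1 - q.1)) ^+ 2 * y by move=> x y; ring.
by rewrite dP; ring.
Qed.

End TwoPoints.

(** * The Jacobi identity at three points *)

Section ThreePoints.

Variables (K : numFieldType) (T : comNzRingType) (s : {rmorphism K -> T}).

Variables (m : nat) (t : param K).
Hypothesis m_gt0 : (0 < m)%N.
Hypothesis t1 : t.1.1 = 1.
Hypothesis P_size : (size t.1.2 <= 5)%N.
Hypothesis Q_size : (size t.2 <= 3)%N.

Notation n := m.*2.
Notation D := (der t).
Notation gen := (@gen K n).

Definition eval_pt (p : T * T) := eval s p.1 p.2.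

Definition quo_gen (i j k l : 'I_n) : K := quo t (gen i) (gen j) k l.

Section Term.

Variables (p q r : T * T) (d12 d23 d13 : T).
Hypotheses (p_on : on_curve s t p.1 p.2) (q_on : on_curve s t q.1 q.2)
  (r_on : on_curve s t r.1 r.2).
Hypotheses (d12P : d12 * (p.1 - q.1) = 1) (d23P : d23 * (q.1 - r.1) = 1)
  (d13P : d13 * (p.1 - r.1) = 1).

(** The inner sum over i, j is the bracket of x_a and x_k at p, q. It is the sum
    of the operator A_pq applied to x_k(q) and A_qp applied to x_k(p), so that the
    sums over k and l become brackets of x_b and x_c and their derivatives. *)
Lemma jacobi_term (a b c : 'I_n) :
  \sum_(i < n) \sum_(j < n) \sum_(l < n)
    s (\sum_(k < n) quo_gen a k i j * quo_gen b c k l) *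
    (eval_pt p (gen i) * eval_pt q (gen j) * eval_pt r (gen l))
  = jterm n%:R (lambda s t p q d12) (lambda s t q r d23) (Dlambda s t q r d23)
      (eval_pt p (gen a)) (eval_pt p (D (gen a)))
      (eval_pt q (gen b)) (eval_pt q (D (gen b))) (eval_pt q (D (D (gen b))))
      (eval_pt r (gen b)) (eval_pt r (D (gen b)))
      (eval_pt q (gen c)) (eval_pt q (D (gen c))) (eval_pt q (D (D (gen c))))
      (eval_pt r (gen c)) (eval_pt r (D (gen c)))
  + jterm n%:R (- lambda s t p q d12) (lambda s t p r d13) (Dlambda s t p r d13)
      (eval_pt q (gen a)) (eval_pt q (D (gen a)))
      (eval_pt p (gen b)) (eval_pt p (D (gen b))) (eval_pt p (D (D (gen b))))
      (eval_pt r (gen b)) (eval_pt r (D (gen b)))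
      (eval_pt p (gen c)) (eval_pt p (D (gen c))) (eval_pt p (D (D (gen c))))
      (eval_pt r (gen c)) (eval_pt r (D (gen c))).
Proof.
have Lg (k : 'I_n) : fits (bound m) (gen k) by exact: fits_gen.
rewrite /jterm -!(quo_eval m_gt0 t1 P_size Q_size _ _ _ (Lg b) (Lg c)) //.
rewrite -!(quo_eval_der m_gt0 t1 P_size Q_size _ _ _ (Lg b) (Lg c)) //.
transitivity (\sum_(k < n) \sum_(l < n) s (quo_gen b c k l) * eval_pt r (gen l) *
   \sum_(i < n) \sum_(j < n) s (quo_gen a k i j) * (eval_pt p (gen i) * eval_pt q (gen j))).
  transitivity (\sum_(i < n) \sum_(j < n) \sum_(k < n) \sum_(l < n)
     s (quo_gen b c k l) * eval_pt r (gen l) * (s (quo_gen a k i j) * (eval_pt p (gen i) * eval_pt q (gen j)))).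
    apply: eq_bigr => i _; apply: eq_bigr => j _; rewrite exchange_big.
    apply: eq_bigr => l _; rewrite rmorph_sum mulr_suml; apply: eq_bigr => k _.
    by rewrite rmorphM; ring.
  rewrite exchange_big; under eq_bigr => j _ do rewrite exchange_big.
  rewrite exchange_big; apply: eq_bigr => k _.
  under eq_bigr => j _ do rewrite exchange_big.
  rewrite exchange_big; apply: eq_bigr => l _.
  rewrite exchange_big mulr_sumr; apply: eq_bigr => i _.
  by rewrite mulr_sumr.
rewrite !mulr_sumr -!big_split; apply: eq_bigr => k _ /=.
rewrite !mulr_sumr -!big_split; apply: eq_bigr => l _ /=.
rewrite (quo_eval m_gt0 t1 P_size Q_size p_on q_on d12P (Lg a) (Lg k)) /bracket_val /quo_gen /eval_pt.
ring.
Qed.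

End Term.

Variables (p1 p2 p3 : T * T) (d12 d13 d23 : T).
Hypotheses (on1 : on_curve s t p1.1 p1.2) (on2 : on_curve s t p2.1 p2.2)
  (on3 : on_curve s t p3.1 p3.2).
Hypotheses (d12P : d12 * (p1.1 - p2.1) = 1) (d13P : d13 * (p1.1 - p3.1) = 1)
  (d23P : d23 * (p2.1 - p3.1) = 1).
Hypothesis free3 : forall c : 'I_n -> 'I_n -> 'I_n -> K,
  \sum_(i < n) \sum_(j < n) \sum_(l < n)
    s (c i j l) * (eval_pt p1 (gen i) * eval_pt p2 (gen j) * eval_pt p3 (gen l)) = 0 ->
  forall i j l, c i j l = 0.

(** By independence it suffices to evaluate at the three points; the cyclic
    rotations of the indices become the cyclic rotations of the points, and each
    of them accounts for two of the six orders. *)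
Lemma quo_jacobi (a b c : 'I_n) :
  forall i j l, let S i j l := \sum_(k < n) (quo_gen a k i j * quo_gen b c k l
       + quo_gen b k i j * quo_gen c a k l + quo_gen c k i j * quo_gen a b k l) in
     S i j l + S j l i + S l i j = 0.
Proof.
pose S i j l := \sum_(k < n) (quo_gen a k i j * quo_gen b c k l
       + quo_gen b k i j * quo_gen c a k l + quo_gen c k i j * quo_gen a b k l).
apply: (free3 (c := fun i j l => S i j l + S j l i + S l i j)).
pose X q1 q2 q3 := \sum_(i < n) \sum_(j < n) \sum_(l < n)
    s (S i j l) * (eval_pt q1 (gen i) * eval_pt q2 (gen j) * eval_pt q3 (gen l)).
transitivity (X p1 p2 p3 + X p2 p3 p1 + X p3 p1 p2).
  rewrite {2}/X -(sum_cyc (fun i j l => s (S i j l) * (eval_pt p2 (gen i) * eval_pt p3 (gen j) * eval_pt p1 (gen l)))).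
  rewrite {2}/X -(sum_cyc (fun i j l => s (S i j l) * (eval_pt p3 (gen i) * eval_pt p1 (gen j) * eval_pt p2 (gen l)))).
  rewrite -(sum_cyc (fun i j l => s (S j l i) * (eval_pt p3 (gen j) * eval_pt p1 (gen l) * eval_pt p2 (gen i)))).
  rewrite /X -!big_split; apply: eq_bigr => i _; rewrite -!big_split; apply: eq_bigr => j _.
  by rewrite -!big_split; apply: eq_bigr => l _; rewrite /= !rmorphD; ring.
have XE q1 q2 q3 e12 e13 e23 : on_curve s t q1.1 q1.2 -> on_curve s t q2.1 q2.2 ->
    on_curve s t q3.1 q3.2 -> e12 * (q1.1 - q2.1) = 1 -> e23 * (q2.1 - q3.1) = 1 ->
    e13 * (q1.1 - q3.1) = 1 -> X q1 q2 q3 =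
    \sum_(i < n) \sum_(j < n) \sum_(l < n)
    s (\sum_(k < n) quo_gen a k i j * quo_gen b c k l) *
    (eval_pt q1 (gen i) * eval_pt q2 (gen j) * eval_pt q3 (gen l)) +
    \sum_(i < n) \sum_(j < n) \sum_(l < n)
    s (\sum_(k < n) quo_gen b k i j * quo_gen c a k l) *
    (eval_pt q1 (gen i) * eval_pt q2 (gen j) * eval_pt q3 (gen l)) +
    \sum_(i < n) \sum_(j < n) \sum_(l < n)
    s (\sum_(k < n) quo_gen c k i j * quo_gen a b k l) *
    (eval_pt q1 (gen i) * eval_pt q2 (gen j) * eval_pt q3 (gen l)).
  move=> *; rewrite /X -!big_split; apply: eq_bigr => i _; rewrite -!big_split; apply: eq_bigr => j _.
  rewrite -!big_split; apply: eq_bigr => l _; rewrite /= /S !big_split /= !rmorphD; ring.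
have N (e : T) (x y : T) : e * (x - y) = 1 -> - e * (y - x) = 1 by move=> <-; ring.
have d21P := N _ _ _ d12P; have d31P := N _ _ _ d13P; have d32P := N _ _ _ d23P.
rewrite (XE _ _ _ _ _ _ on1 on2 on3 d12P d23P d13P) (XE _ _ _ _ _ _ on2 on3 on1 d23P d31P d21P).
rewrite (XE _ _ _ _ _ _ on3 on1 on2 d31P d12P d32P).
rewrite !(jacobi_term on1 on2 on3 d12P d23P d13P).
rewrite !(jacobi_term on2 on3 on1 d23P d31P d21P).
rewrite !(jacobi_term on3 on1 on2 d31P d12P d32P).
have L q1 q2 e : lambda s t q2 q1 (- e) = - lambda s t q1 q2 e by rewrite /lambda; ring.
rewrite !L !opprK.
have := @jsum_cyc T n%:R (lambda s t p1 p2 d12) (lambda s t p1 p3 d13) (lambda s t p2 p3 d23) _ _ _ _ _ _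
  _ _ _
  (eval_pt p1 (gen a)) (eval_pt p2 (gen a)) (eval_pt p3 (gen a))
  (eval_pt p1 (D (gen a))) (eval_pt p2 (D (gen a))) (eval_pt p3 (D (gen a)))
  (eval_pt p1 (D (D (gen a)))) (eval_pt p2 (D (D (gen a)))) (eval_pt p3 (D (D (gen a))))
  (eval_pt p1 (gen b)) (eval_pt p2 (gen b)) (eval_pt p3 (gen b))
  (eval_pt p1 (D (gen b))) (eval_pt p2 (D (gen b))) (eval_pt p3 (D (gen b)))
  (eval_pt p1 (D (D (gen b)))) (eval_pt p2 (D (D (gen b)))) (eval_pt p3 (D (D (gen b))))
  (eval_pt p1 (gen c)) (eval_pt p2 (gen c)) (eval_pt p3 (gen c))
  (eval_pt p1 (D (gen c))) (eval_pt p2 (D (gen c))) (eval_pt p3 (D (gen c)))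
  (eval_pt p1 (D (D (gen c)))) (eval_pt p2 (D (D (gen c)))) (eval_pt p3 (D (D (gen c))))
  (Dlambda_sub P_size Q_size on1 on2 d12P) (Dlambda_sub P_size Q_size on1 on3 d13P)
  (Dlambda_sub P_size Q_size on2 on3 d23P).
move=> E; rewrite -[RHS]E /jsum.
ring.
Qed.

End ThreePoints.

(** * Generic points of the curve *)

Lemma gen_inj n (k l : 'I_n) : gen_odd k = gen_odd l -> gen_exp k = gen_exp l -> k = l.
Proof.
move=> kl; rewrite /gen_exp -kl; move: kl; rewrite /gen_odd /gen_index => kl E.
apply: val_inj; move: kl E => /=.
by case: (eqVneq (k : nat) 0%N) => k0; case: (eqVneq (l : nat) 0%N) => l0 //=;
  do ?case: ifP; lia.
Qed.

Section CurveModule.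

Variables (A : comNzRingType) (P Q : {poly A}).

Notation C := (curve P Q).
Notation pi := (curve_pi P Q).
Notation F := (curve_f P Q).
Notation G := (curve_g P Q).

Definition up : {rmorphism A -> C} := in_alg C.

Lemma up_pi a : up a = pi a%:P%:P.
Proof. by rewrite curve_piC. Qed.

Definition lift_mon n (k : 'I_n) : {poly {poly A}} :=
  if gen_odd k then 'X^(gen_exp k) *: 'X else ('X^(gen_exp k))%:P.

Lemma lift_monE n (k : 'I_n) :
  F ^+ gen_exp k * (if gen_odd k then G else 1) = pi (lift_mon k).
Proof.
rewrite /lift_mon; case: (gen_odd k); first by rewrite -mul_polyC rmorphM polyC_exp rmorphXn.
by rewrite mulr1 polyC_exp rmorphXn.
Qed.

(** Representatives of degree at most one in g over A[f] are unique. *)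
Lemma curve_free n (a : 'I_n -> A) :
  \sum_(k < n) up (a k) * (F ^+ gen_exp k * (if gen_odd k then G else 1)) = 0 -> forall k, a k = 0.
Proof.
pose M := \sum_(k < n) (a k)%:P *: lift_mon k.
have -> : \sum_(k < n) up (a k) * (F ^+ gen_exp k * (if gen_odd k then G else 1)) = pi M.
  rewrite rmorph_sum; apply: eq_bigr => k _.
  by rewrite lift_monE up_pi -rmorphM mul_polyC.
move=> piM k.
have sM : (size M <= 2)%N.
  apply: leq_trans (size_sum _ _ _) _; apply/bigmax_leqP => l _.
  apply: leq_trans (size_scale_leq _ _) _; rewrite /lift_mon; case: gen_odd.
    by apply: leq_trans (size_scale_leq _ _) _; rewrite size_polyX.
  exact: leq_trans (size_polyC_leq1 _) _.
have M0 : M = 0 by rewrite -(curve_pi_val P Q sM) piM.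
have := congr1 (fun p : {poly {poly A}} => p`_(gen_odd k)`_(gen_exp k)) M0.
rewrite !coef0 /M coef_sum coef_sum (bigD1 k) //= big1 => [|l lk].
  rewrite addr0 coefZ mul_polyC coefZ /lift_mon; case: (gen_odd k).
    by rewrite coefZ coefX mulr1 coefXn eqxx mulr1.
  by rewrite coefC coefXn eqxx mulr1.
rewrite coefZ mul_polyC coefZ /lift_mon.
case pl: (gen_odd l); case pk: (gen_odd k); rewrite ?coefZ ?coefX ?coefC /= ?mulr0 ?mulr1 ?coef0 ?if_same ?mulr0 //.
  rewrite coefXn; case: eqP => [kl|]; last by rewrite mulr0.
  by case/eqP: lk; apply: gen_inj; rewrite ?pl ?pk.
rewrite coefXn; case: eqP => [kl|]; last by rewrite mulr0.
by case/eqP: lk; apply: gen_inj; rewrite ?pl ?pk.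
Qed.

Lemma lreg_pi (c : {poly A}) : GRing.lreg c -> GRing.lreg (pi c%:P).
Proof.
move=> rc; have valM (h : C) : val (pi c%:P * h) = c *: (val h : {poly {poly A}}).
  rewrite -[h in LHS]curve_valK -rmorphM curve_pi_val mul_polyC //.
  by rewrite (leq_trans (size_scale_leq _ _)) ?size_curve.
move=> h k /(congr1 val); rewrite !valM => /polyP hk.
apply: val_inj; apply/polyP => i; apply: rc.
by have := hk i; rewrite !coefZ.
Qed.

Lemma lreg_up a : GRing.lreg a -> GRing.lreg (up a).
Proof.
move=> ra; rewrite up_pi; apply: lreg_pi => p q /polyP pq; apply/polyP => i.
by apply: ra; have := pq i; rewrite !mul_polyC !coefZ.
Qed.

Lemma lreg_up_sub a : GRing.lreg (up a - F).
Proof.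
have -> : up a - F = pi (a%:P - 'X)%:P by rewrite up_pi polyCB raddfB.
apply: lreg_pi.
apply: lreg_lead; rewrite -opprB lead_coefN lead_coefXsubC.
by apply: lregN; exact: lreg1.
Qed.

End CurveModule.

Lemma eval_gen (K : numFieldType) (T : comNzRingType) (s : {rmorphism K -> T}) f g n (k : 'I_n) :
  eval s f g (gen K k) = f ^+ gen_exp k * (if gen_odd k then g else 1).
Proof.
rewrite /gen /mon /eval /evalp; case: (gen_odd k) => /=.
  by rewrite rmorph0 horner0 add0r map_polyXn hornerXn.
by rewrite rmorph0 horner0 mul0r addr0 mulr1 map_polyXn hornerXn.
Qed.

Section GenericPoints.

Variable K : numFieldType.

Lemma evalp_morph (A C : comNzRingType) (v : {rmorphism K -> A}) (u : {rmorphism A -> C}) f p :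
  evalp (u \o v) (u f) p = u (evalp v f p).
Proof. by rewrite /evalp map_poly_comp horner_map. Qed.

Lemma eval_morph (A C : comNzRingType) (v : {rmorphism K -> A}) (u : {rmorphism A -> C}) f g h :
  eval (u \o v) (u f) (u g) h = u (eval v f g h).
Proof. by rewrite /eval !evalp_morph rmorphD rmorphM. Qed.

Lemma on_curve_morph (A C : comNzRingType) (v : {rmorphism K -> A}) (u : {rmorphism A -> C})
    (t : param K) f g : on_curve v t f g -> on_curve (u \o v) t (u f) (u g).
Proof.
by rewrite /on_curve /evalp !map_poly_comp !horner_map -rmorphXn => ->; rewrite rmorphD rmorphM.
Qed.

(** Over any base ring, adjoining a point of the curve gives an extension in which
    the functions f^i g^e are independent at this point. *)
Lemma generic_point (A : comNzRingType) (v : {rmorphism K -> A}) (t : param K) n :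
  exists (C : comNzRingType) (u : {rmorphism A -> C}) (f g : C),
  [/\ on_curve (u \o v) t f g,
      forall a : 'I_n -> A,
        \sum_(k < n) u (a k) * eval (u \o v) f g (gen K k) = 0 -> forall k, a k = 0,
      forall a, GRing.lreg a -> GRing.lreg (u a)
    & forall a, GRing.lreg (u a - f)].
Proof.
case: t => -[z P] Q.
exists (curve (map_poly v P) (map_poly v Q)), (up (map_poly v P) (map_poly v Q)).
exists (curve_f (map_poly v P) (map_poly v Q)), (curve_g (map_poly v P) (map_poly v Q)).
split.
- by rewrite /on_curve /evalp /= !map_poly_comp; exact: curve_relE.
- move=> a a0; apply: (@curve_free _ (map_poly v P) (map_poly v Q)).
  by rewrite -[RHS]a0; apply: eq_bigr => k _; rewrite eval_gen.
- exact: lreg_up.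
- exact: lreg_up_sub.
Qed.

(** Three successive adjunctions of a point give the tensor cube of the curve
    algebra, where the differences of the f-coordinates are regular; they become
    invertible in the total ring of fractions. Points over a field would not do:
    when R = 0 the function y vanishes at all of them. *)
Lemma three_points (t : param K) n :
  exists (T : comNzRingType) (s : {rmorphism K -> T}) (p1 p2 p3 : T * T) (d12 d13 d23 : T),
  [/\ [/\ on_curve s t p1.1 p1.2, on_curve s t p2.1 p2.2 & on_curve s t p3.1 p3.2],
      [/\ d12 * (p1.1 - p2.1) = 1, d13 * (p1.1 - p3.1) = 1 & d23 * (p2.1 - p3.1) = 1]
    & forall c : 'I_n -> 'I_n -> 'I_n -> K,
      \sum_(i < n) \sum_(j < n) \sum_(l < n)
        s (c i j l) * (eval_pt s p1 (gen K i) * eval_pt s p2 (gen K j) * eval_pt s p3 (gen K l)) = 0 ->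
      forall i j l, c i j l = 0].
Proof.
have [C1 [u1 [f1 [g1 [on1 free1 _ _]]]]] := generic_point idfun t n.
have [C2 [u2 [f2 [g2 [on2 free2 _ sub2]]]]] := generic_point (u1 \o idfun) t n.
have [C3 [u3 [f3 [g3 [on3 free3 up3 sub3]]]]] := generic_point (u2 \o (u1 \o idfun)) t n.
pose v1 : {rmorphism K -> C1} := u1 \o idfun.
pose v2 : {rmorphism K -> C2} := u2 \o v1.
pose v3 : {rmorphism K -> C3} := u3 \o v2.
pose w : {rmorphism C3 -> {totfrac C3}} := @TotalFrac.tofrac C3.
exists {totfrac C3}, (w \o v3).
exists (w (u3 (u2 f1)), w (u3 (u2 g1))), (w (u3 f2), w (u3 g2)), (w f3, w g3).
exists (fract 1 (u3 (u2 f1 - f2))), (fract 1 (u3 (u2 f1) - f3)), (fract 1 (u3 f2 - f3)).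
split.
- split=> /=; apply: (on_curve_morph w); first last.
  + exact: on3.
  + exact: (on_curve_morph u3 on2).
  + exact: (on_curve_morph u3 (on_curve_morph u2 on1)).
- have fractV (x : C3) : GRing.lreg x -> fract 1 x * w x = 1.
    by move=> rx; rewrite mulrC [LHS](TotalFrac.fractP 1 rx); exact: rmorph1.
  split=> /=; rewrite -rmorphB.
  + by rewrite -rmorphB; apply: fractV; apply: up3; exact: sub2.
  + by apply: fractV; exact: sub3.
  + by apply: fractV; exact: sub3.
move=> c; pose e1 (i : 'I_n) := eval v1 f1 g1 (gen K i).
pose e2 (j : 'I_n) := eval v2 f2 g2 (gen K j); pose e3 (l : 'I_n) := eval v3 f3 g3 (gen K l).
have -> : \sum_(i < n) \sum_(j < n) \sum_(l < n) (w \o v3) (c i j l) *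
    (eval_pt (w \o v3) (w (u3 (u2 f1)), w (u3 (u2 g1))) (gen K i) *
     eval_pt (w \o v3) (w (u3 f2), w (u3 g2)) (gen K j) *
     eval_pt (w \o v3) (w f3, w g3) (gen K l))
  = w (\sum_(l < n) u3 (\sum_(j < n) u2 (\sum_(i < n) v1 (c i j l) * e1 i) * e2 j) * e3 l).
  have E1 (i : 'I_n) : eval_pt (w \o v3) (w (u3 (u2 f1)), w (u3 (u2 g1))) (gen K i) = w (u3 (u2 (e1 i))).
    by rewrite /eval_pt /= !eval_morph.
  have E2 (j : 'I_n) : eval_pt (w \o v3) (w (u3 f2), w (u3 g2)) (gen K j) = w (u3 (e2 j)).
    by rewrite /eval_pt /= !eval_morph.
  have E3 (l : 'I_n) : eval_pt (w \o v3) (w f3, w g3) (gen K l) = w (e3 l).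
    by rewrite /eval_pt /= !eval_morph.
  under eq_bigr => i _ do rewrite exchange_big /=.
  rewrite exchange_big rmorph_sum; apply: eq_bigr => l _ /=.
  rewrite exchange_big rmorphM !rmorph_sum mulr_suml; apply: eq_bigr => j _ /=.
  rewrite !(rmorphM, rmorph_sum) !mulr_suml; apply: eq_bigr => i _ /=.
  by rewrite !rmorphM E1 E2 E3; ring.
move=> wc0 i j l; have c0 := TotalFrac.tofrac_inj (etrans wc0 (esym (rmorph0 w))).
have c1 := free3 _ c0 l.
have c2 := free2 _ c1 j.
by have := free1 (fun i => c i j l) c2 i.
Qed.

End GenericPoints.

(** * The Poisson bracket of a parameter *)

Section EvenBracket.

Variables (K : numFieldType) (m : nat).
Hypothesis m_gt0 : (0 < m)%N.

Notation n := m.*2.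

Definition ev_bracket (t : param K) : bracket K n := quad_bracket (@quo_gen K m t).

Lemma quo_paramP c t t' (u v : pair_poly K) (k l : 'I_n) :
  quo (c *: t + t') u v k l = c * quo t u v k l + quo t' u v k l.
Proof.
rewrite /quo /divtab mulr_sumr -big_split; apply: eq_bigr => d _ /=.
by rewrite /numer /alt_coef !(euler_paramP, der_paramP) !coordP !(coefD, coefZ); ring.
Qed.

Lemma ev_bracket_paramP c t t' p q :
  ev_bracket (c *: t + t') p q = c *: ev_bracket t p q + ev_bracket t' p q.
Proof.
rewrite scaler_sumr -big_split; apply: eq_bigr => k _ /=.
rewrite scaler_sumr -big_split; apply: eq_bigr => l _ /=.
have -> : quad_tab (@quo_gen K m (c *: t + t')) k l
    = c *: quad_tab (@quo_gen K m t) k l + quad_tab (@quo_gen K m t') k l.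
  rewrite scaler_sumr -big_split; apply: eq_bigr => i _ /=.
  rewrite scaler_sumr -big_split; apply: eq_bigr => j _ /=.
  by rewrite scalerA -scalerDl /quo_gen quo_paramP mulrDr mulrCA.
by rewrite -!mul_mpolyC; ring.
Qed.

Lemma ev_biderivation t : is_biderivation (ev_bracket t).
Proof. exact: tab_biderivation. Qed.

Lemma ev_bracketX t i j : ev_bracket t 'X_i 'X_j = quad_tab (@quo_gen K m t) i j.
Proof. exact: tab_bracketX. Qed.

Lemma ev_quadratic t : is_quadratic (ev_bracket t).
Proof. by move=> i j; rewrite ev_bracketX; exact: qform_homog. Qed.

Definition admissible (t : param K) := (size t.1.2 <= 5)%N /\ (size t.2 <= 3)%N.

Lemma ev_poisson1 t : t.1.1 = 1 -> admissible t -> is_poisson (ev_bracket t).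
Proof.
move=> t1 [Ps Qs]; apply: poisson_of_gens => [|i j|i j k].
- exact: ev_biderivation.
- rewrite !ev_bracketX /quad_tab /qform -sumrN; apply: eq_bigr => k _.
  rewrite -sumrN; apply: eq_bigr => l _.
  by rewrite /quo_gen quo_alt mulrN scaleNr.
apply: quad_jacobi => [a b c d|]; first exact: quo_sym.
have [T [s [p1 [p2 [p3 [d12 [d13 [d23 [[on1 on2 on3] [e12 e13 e23] free3]]]]]]]]] :=
  three_points t n.
exact: (quo_jacobi m_gt0 t1 Ps Qs on1 on2 on3 e12 e13 e23 free3).
Qed.

Lemma ev_bracketZ c t p q : ev_bracket (c *: t) p q = c *: ev_bracket t p q.
Proof.
have b0 : ev_bracket 0 p q = 0.
  by have := ev_bracket_paramP (-1) 0 0 p q; rewrite scaler0 addr0 scaleN1r addNr.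
by have := ev_bracket_paramP c t 0 p q; rewrite addr0 b0 addr0.
Qed.

(** For z != 0 the bracket is a multiple of one with z = 1, and z = 0 follows from
    the parameters with z = 1 and z = -1. *)
Lemma ev_poisson t : admissible t -> is_poisson (ev_bracket t).
Proof.
move=> adm; have [z0|z0] := eqVneq t.1.1 0; last first.
  apply: (poissonZ (B := ev_bracket (t.1.1^-1 *: t)) (c := t.1.1)); last first.
    by move=> p q; rewrite -ev_bracketZ scalerA mulfV // scale1r.
  apply: ev_poisson1; first by rewrite /= -[LHS]/(t.1.1^-1 * t.1.1) mulVf.
  by case: adm => Ps Qs; split; apply: (leq_trans (size_scale_leq _ _)).
(* Now z = 0: adding a multiple of e leads back to nonzero z. *)
pose e : param K := (1, 0, 0).
have Pe : is_poisson (ev_bracket e).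
  by apply: ev_poisson1 => //; split; rewrite size_poly0.
have Px x : x != 0 -> is_poisson (ev_bracket (x *: e + t)).
  move=> x0; apply: (poissonZ (B := ev_bracket (x^-1 *: (x *: e + t))) (c := x)); last first.
    by move=> p q; rewrite -ev_bracketZ scalerA mulfV // scale1r.
  apply: ev_poisson1.
    by rewrite /= z0 addr0 -[LHS]/(x^-1 * (x * 1)) mulr1 mulVf.
  case: adm => Ps Qs; split; apply: (leq_trans (size_scale_leq _ _));
    by rewrite /= scaler0 add0r.
apply: (poisson_limit _ Pe (Px 1 (oner_neq0 _)) (Px (-1) _)).
- exact: ev_biderivation.
- by rewrite oppr_eq0 oner_neq0.
- by move=> p q; rewrite ev_bracket_paramP scale1r.
- by move=> p q; rewrite ev_bracket_paramP scaleN1r.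
Qed.

End EvenBracket.

(** * Quadratic forms as symmetric tensors *)

Section SymTensor.

Variables (K : numFieldType) (n : nat) (S : comNzRingType) (s : {rmorphism K -> S}).
Variables X Y : 'I_n -> S.

(** The symmetric tensor of a quadratic form, with generators of the two tensor
    factors in an arbitrary ring S. *)
Definition sym_tensor (p : {mpoly K[n]}) : S :=
  \sum_(k < n) \sum_(l < n | (k <= l)%N)
    s (p@_(U_(k) + U_(l))) * (X k * Y l + X l * Y k).

Lemma sym_tensorP c p q : sym_tensor (c *: p + q) = s c * sym_tensor p + sym_tensor q.
Proof. by apply: sum_lin2 => k l; rewrite mcoeffD mcoeffZ rmorphD rmorphM. Qed.

Lemma sym_tensorX i j : sym_tensor ('X_i * 'X_j) = X i * Y j + X j * Y i.
Proof.
wlog ij : i j / (i <= j)%N.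
  move=> H; have [/H //|/ltnW /H] := leqP i j.
  by rewrite mulrC addrC.
apply: (sum_pick2 (c := fun k l => s _)) => // k l kl.
by rewrite -mpolyXD mcoeffX mnm2_eq // rmorph_nat.
Qed.

Lemma sym_tensor_sumZ (I : Type) (r : seq I) (c : I -> K) (p : I -> {mpoly K[n]}) :
  sym_tensor (\sum_(i <- r) c i *: p i) = \sum_(i <- r) s (c i) * sym_tensor (p i).
Proof.
have S0 : sym_tensor 0 = 0.
  have := sym_tensorP (-1) 0 0.
  by rewrite scaler0 addr0 rmorphN rmorph1 mulN1r addNr.
by elim/big_rec2: _ => [|i x y _ <-] //; rewrite sym_tensorP.
Qed.

Lemma sym_tensor_qform w : (forall k l, w k l = w l k) ->
  sym_tensor (qform w) = \sum_(k < n) \sum_(l < n) s (w k l) * (X k * Y l).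
Proof.
move=> w_sym; pose h : K := 2^-1.
transitivity (\sum_(k < n) \sum_(l < n) s (h * w k l) * (X k * Y l + X l * Y k)).
  rewrite /qform (eq_bigr (fun k => 1 *: \sum_(l < n) (h * w k l) *: ('X_k * 'X_l))); last first.
    by move=> k _; rewrite scale1r.
  rewrite sym_tensor_sumZ; apply: eq_bigr => k _; rewrite rmorph1 mul1r sym_tensor_sumZ.
  by apply: eq_bigr => l _; rewrite sym_tensorX.
transitivity (\sum_(k < n) \sum_(l < n) s (h * w k l) * (X k * Y l)
   + \sum_(k < n) \sum_(l < n) s (h * w k l) * (X l * Y k)).
  rewrite -big_split; apply: eq_bigr => k _; rewrite -big_split; apply: eq_bigr => l _.
  by rewrite /= mulrDr.
rewrite [X in _ + X = _]exchange_big -big_split; apply: eq_bigr => k _.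
rewrite -big_split; apply: eq_bigr => l _ /=.
rewrite [w l k]w_sym -mulrDl -rmorphD -mulrDl.
by have -> : h + h = 1 by [rewrite /h; field]; rewrite mul1r.
Qed.

Hypothesis free2 : forall c : 'I_n -> 'I_n -> K,
  \sum_(k < n) \sum_(l < n) s (c k l) * (X k * Y l) = 0 -> forall k l, c k l = 0.

Lemma mdeg2 (M : 'X_{1.. n}) : mdeg M = 2 -> exists k l : 'I_n, (k <= l)%N /\ M = (U_(k) + U_(l))%MM.
Proof.
move=> M2; have [i Mi] : exists i, M i != 0%N.
  apply/existsP; rewrite -[X in is_true X]negbK negb_exists; apply/negP => /forallP M0.
  suff : mdeg M = 0%N by rewrite M2.
  by rewrite mdegE big1 // => i _; apply/eqP; have := M0 i; rewrite negbK.
have Ui : (U_(i) <= M)%MM by rewrite lep1mP.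
have [j Mj] : exists j, (M - U_(i))%MM == U_(j)%MM.
  by apply/existsP; rewrite -mdeg_eq1 -(eqn_add2r (mdeg U_(i)%MM)) -mdegD submK // M2 mdeg1.
have ME : M = (U_(i) + U_(j))%MM by rewrite -(eqP Mj) addmC submK.
have [ij|ji] := leqP i j; first by exists i, j.
by exists j, i; split; [exact: ltnW | rewrite ME addmC].
Qed.

(** The tensor x_k (x) x_l with k != l has the coefficient of x_k x_l, and
    x_k (x) x_k has twice the coefficient of x_k^2. *)
Lemma sym_tensor_inj p q : p \is 2.-homog -> q \is 2.-homog ->
  sym_tensor p = sym_tensor q -> p = q.
Proof.
move=> p2 q2 pq; apply/eqP; rewrite -subr_eq0; apply/eqP.
set d := p - q; have d2 : d \is 2.-homog by rewrite rpredB.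
have d0 : sym_tensor d = 0.
  by have := sym_tensorP (-1) q p; rewrite scaleN1r addrC -/d => ->; rewrite pq rmorphN rmorph1 mulN1r addNr.
pose c k l := d@_(U_(k) + U_(l)).
have c_sym k l : c k l = c l k by rewrite /c addmC.
(* The diagonal occurs twice in the symmetric tensor. *)
pose w k l := c k l * ((k <= l)%N%:R + (l <= k)%N%:R).
have w0 : forall k l, w k l = 0.
  apply: free2; rewrite -[RHS]d0 /sym_tensor.
  transitivity (\sum_(k < n) \sum_(l < n) (if (k <= l)%N then s (c k l) * (X k * Y l) else 0)
     + \sum_(k < n) \sum_(l < n) (if (l <= k)%N then s (c k l) * (X k * Y l) else 0)).
    rewrite -big_split; apply: eq_bigr => k _; rewrite -big_split; apply: eq_bigr => l _ /=.
    rewrite /w rmorphM rmorphD !rmorph_nat.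
    by case: (k <= l)%N; case: (l <= k)%N => /=; ring.
  rewrite [X in _ + X = _]exchange_big -big_split; apply: eq_bigr => k _.
  rewrite [RHS]big_mkcond -big_split; apply: eq_bigr => l _ /=.
  by rewrite -/(c k l) [c l k]c_sym; case: ifP; rewrite ?addr0 // mulrDr.
apply/mpolyP => M; rewrite mcoeff0.
have [M2|M2] := eqVneq (mdeg M) 2; last exact: dhomog_nemf_coeff d2 M2.
have [k [l [kl ->]]] := mdeg2 M2.
have /eqP := w0 k l; rewrite /w -/(c k l) kl mulf_eq0 => /orP [/eqP //|].
by rewrite -natrD pnatr_eq0.
Qed.

End SymTensor.

(** * Comparison with the formula in the ring of fractions *)

(** The formula is checked after multiplication by e = f_1 - f_2, which is
    invertible among the fractions. *)
Lemma frac_formula (S : comNzRingType) (n : nat) (e x y z W : S) (lamb : {totfrac S}) :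
  GRing.lreg e -> Defs.tofrac e * lamb = Defs.tofrac y ->
  e * W = n%:R * y * x + e * z ->
  Defs.tofrac W = n%:R * lamb * Defs.tofrac x + Defs.tofrac z.
Proof.
move=> re el eW; have rW := TotalFrac.fractP 1 re.
have {}rW : fract 1 e * Defs.tofrac e = 1 by rewrite mulrC [LHS]rW rmorph1.
apply: (can_inj (f := fun u => Defs.tofrac e * u) (g := fun u => fract 1 e * u)) => [u|]; first by rewrite mulrA rW mul1r.
rewrite -rmorphM eW rmorphD !rmorphM rmorph_nat /= -el; ring.
Qed.

Section AbstractDerivation.

Variables (K : numFieldType) (S : comNzRingType) (s : {rmorphism K -> S}).

Variables (t : param K) (f g : S) (D : S -> S).
Hypothesis t1 : t.1.1 = 1.
Hypothesis fg_on : on_curve s t f g.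
Hypothesis DD : forall x y, D (x + y) = D x + D y.
Hypothesis DM : forall x y, D (x * y) = D x * y + x * D y.
Hypothesis Ds : forall c, D (s c) = 0.
Hypothesis Df : D f = 2 * g - evalp s f t.2.
Hypothesis Dg : D g = evalp s f t.1.2^`() + evalp s f t.2^`() * g.

Lemma der_evp p : D (evalp s f p) = evalp s f p^`() * D f.
Proof.
elim/poly_ind: p => [|p c IHp].
  by rewrite deriv0 /evalp rmorph0 horner0 mul0r -(rmorph0 s) Ds rmorph0.
have cE d : evalp s f d%:P = s d by rewrite /evalp map_polyC hornerC.
rewrite derivD derivM derivX derivC mulr1 addr0 !evalpE cE.
by rewrite DD DM IHp Ds; ring.
Qed.

(** A derivation of a ring with a point f, g on the curve is determined on the
    functions at this point by its values at f and g. *)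
Lemma der_ev h : D (eval s f g h) = eval s f g (der t h).
Proof.
rewrite /eval DD DM !der_evp Dg Df /der /= !evalpE t1 mulr1 rmorph_nat.
have -> : forall x y z w, x * (2 * g - y) + (z * (2 * g - y) * g + w)
  = x * (2 * g - y) + 2 * z * g ^+ 2 - z * y * g + w by move=> *; ring.
by rewrite fg_on; ring.
Qed.

End AbstractDerivation.

Section Vectors.

Variables (K : numFieldType) (m : nat).

Notation n := m.*2.

Definition vec_pair (u : 'I_n -> K) : pair_poly K := \sum_(k < n) u k *: gen K k.

Lemma fits_vec u : fits (bound m) (vec_pair u).
Proof. by apply: fits_sum => k _; exact: fits_gen. Qed.

Lemma quoP_l t c (u u' v : pair_poly K) (k l : 'I_n) :
  quo t (c *: u + u') v k l = c * quo t u v k l + quo t u' v k l.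
Proof.
rewrite /quo /divtab mulr_sumr -big_split; apply: eq_bigr => d _ /=.
by rewrite /numer /alt_coef eulerP derP mul_fP !coordP !(coefD, coefZ); ring.
Qed.

Lemma quo_suml t (I : Type) (r : seq I) (c : I -> K) (h : I -> pair_poly K) v (k l : 'I_n) :
  quo t (\sum_(i <- r) c i *: h i) v k l = \sum_(i <- r) c i * quo t (h i) v k l.
Proof.
have q0 : quo t 0 v k l = 0.
  by have := quoP_l t (-1) 0 0 v k l; rewrite scaler0 addr0; move: (quo _ _ _ _ _) => z; rewrite mulN1r addNr.
by elim/big_rec2: _ => [|i x y _ <-] //; rewrite quoP_l.
Qed.

Lemma quo_sumr t (I : Type) (r : seq I) (c : I -> K) (h : I -> pair_poly K) v (k l : 'I_n) :
  quo t v (\sum_(i <- r) c i *: h i) k l = \sum_(i <- r) c i * quo t v (h i) k l.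
Proof.
rewrite quo_alt quo_suml -sumrN; apply: eq_bigr => i _.
by rewrite [in RHS]quo_alt mulrN.
Qed.

Lemma ev_bracket_vec t (u v : 'I_n -> K) :
  ev_bracket t (vec_S u) (vec_S v) = qform (quo t (vec_pair u) (vec_pair v)).
Proof.
have bB := ev_biderivation m t; rewrite /vec_S biderivation_suml //.
transitivity (\sum_(i < n) \sum_(j < n) \sum_(k < n) \sum_(l < n)
    (u i * v j * (2^-1 * quo t (gen K i) (gen K j) k l)) *: ('X_k * 'X_l : {mpoly K[n]})).
  apply: eq_bigr => i _; rewrite biderivation_sumr // scaler_sumr; apply: eq_bigr => j _.
  rewrite ev_bracketX !scaler_sumr; apply: eq_bigr => k _.
  by rewrite !scaler_sumr; apply: eq_bigr => l _; rewrite !scalerA mulrA.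
under eq_bigr => i _ do rewrite exchange_big /=.
rewrite exchange_big; apply: eq_bigr => k _.
under eq_bigr => i _ do rewrite exchange_big /=.
rewrite exchange_big; apply: eq_bigr => l _.
rewrite quo_suml mulr_sumr scaler_suml; apply: eq_bigr => i _.
rewrite quo_sumr mulr_sumr mulr_sumr scaler_suml; apply: eq_bigr => j _.
by congr (_ *: _); ring.
Qed.

End Vectors.

Lemma sum_mul_swap (S : comNzRingType) n (c : 'I_n -> 'I_n -> S) (X Y : 'I_n -> S) :
  \sum_(k < n) \sum_(l < n) c k l * (X k * Y l)
  = \sum_(l < n) (\sum_(k < n) c k l * X k) * Y l.
Proof.
rewrite exchange_big; apply: eq_bigr => l _; rewrite mulr_suml.
by apply: eq_bigr => k _; rewrite mulrA.
Qed.

Lemma congr_numerator (S : comNzRingType) (n : nat) (e W W' Y Y' X X' Z Z' : S) :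
  W = W' -> Y = Y' -> X = X' -> Z = Z' ->
  e * W' = n%:R * Y' * X' + e * Z' -> e * W = n%:R * Y * X + e * Z.
Proof. by move=> -> -> -> ->. Qed.

Lemma congr_addBB (S : zmodType) (w w' x x' y y' z z' : S) :
  w = w' -> x = x' -> y = y' -> z = z' -> w + x - y - z = w' + x' - y' - z'.
Proof. by move=> -> -> -> ->. Qed.

Lemma sub_swap (S : zmodType) (w x y z : S) : w + x - y - z = (w - y) + (x - z).
Proof. by rewrite -addrA addrACA. Qed.

Section Link.

Variables (K : numFieldType) (a : 'I_5 -> K) (b : 'I_3 -> K) (m : nat).
Hypothesis m_gt0 : (0 < m)%N.

Notation F := (F_ev a b).
Notation FF := (FF_ev a b).
Notation f := (f_ev a b).
Notation g := (g_ev a b).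
Notation tl := (@tensl _ a b).
Notation tr := (@tensr _ a b).

Notation n := m.*2.

Definition param_ev : param K := (1, P_ev a, Q_ev b).

Definition curve_elt (h : pair_poly K) : F := eval (in_alg F) f g h.

Definition scal_FF : {rmorphism K -> FF} := in_alg FF \o in_alg F.

Lemma param_ev_admissible : admissible param_ev.
Proof.
split; apply: leq_trans (size_sum _ _ _) _; apply/bigmax_leqP => i _;
  by apply: leq_trans (size_scale_leq _ _) _; rewrite size_polyXn.
Qed.

Lemma fg_ev_on : on_curve (in_alg F) param_ev f g.
Proof. exact: g2E. Qed.

Lemma curve_elt_gen (k : 'I_n) : curve_elt (gen K k) = gen_ev a b k.
Proof.
rewrite /curve_elt eval_gen /gen_ev /x_ev /gen_exp -/(gen_odd k).
by case: (gen_odd k); rewrite ?mulr1.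
Qed.

Lemma curve_elt_vec u : curve_elt (vec_pair u) = vec_F a b (u : 'I_n -> K).
Proof.
rewrite /vec_pair /vec_F; have i0 : curve_elt 0 = 0.
  by rewrite /curve_elt /eval /= /evalp rmorph0 horner0 mul0r addr0.
elim/big_rec2: _ => [|k x y _ <-] //.
by rewrite /curve_elt evalP mulr_algl -/(curve_elt _) -/(curve_elt _) curve_elt_gen.
Qed.

Lemma tl_curve_elt h : tl (curve_elt h) = eval scal_FF (tl f) (tl g) h.
Proof. by rewrite -(eval_morph (in_alg F) (tl : {rmorphism F -> FF})). Qed.

Lemma tr_curve_elt h : tr (curve_elt h) = eval scal_FF (tr f) (tr g) h.
Proof.
rewrite -(eval_morph (in_alg F) (tr : {rmorphism F -> FF})) /eval /evalp.
have E p : map_poly (tr \o in_alg F) p = map_poly scal_FF p.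
  by apply: eq_map_poly => c; exact: tensr_alg.
by rewrite !E.
Qed.

Lemma D_curve_elt h : D_ev (curve_elt h) = curve_elt (der param_ev h).
Proof.
have [DL DM Df Dg] := D_evP a b.
have DD (x y : F) : D_ev (x + y) = D_ev x + D_ev y by have := DL 1 x y; rewrite !scale1r.
have Dc c : D_ev (in_alg F c) = 0 by exact: curve_DC.
exact: (@der_ev K F (in_alg F) param_ev f g (@D_ev K a b) erefl fg_ev_on DD DM Dc Df Dg).
Qed.

Lemma fg1_on : on_curve scal_FF param_ev (tl f) (tl g).
Proof. exact: (on_curve_morph (tl : {rmorphism F -> FF}) fg_ev_on). Qed.

Lemma fg2_on : on_curve scal_FF param_ev (tr f) (tr g).
Proof.
have := on_curve_morph (tr : {rmorphism F -> FF}) fg_ev_on; rewrite /on_curve /evalp.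
have E p : map_poly (tr \o in_alg F) p = map_poly scal_FF p.
  by apply: eq_map_poly => c; exact: tensr_alg.
by rewrite !E.
Qed.

Lemma S2_tensorE p : S2_tensor a b p = sym_tensor scal_FF (fun k : 'I_n => tl (gen_ev a b k))
  (fun k => tr (gen_ev a b k)) p.
Proof. by []. Qed.

Lemma tr_gen (k : 'I_n) :
  tr (gen_ev a b k) = tr f ^+ gen_exp k * (if gen_odd k then tr g else 1).
Proof. by rewrite -curve_elt_gen tr_curve_elt eval_gen. Qed.

Lemma tl_sum (c : 'I_n -> K) :
  tl (\sum_(k < n) c k *: gen_ev a b k) = \sum_(k < n) scal_FF (c k) * tl (gen_ev a b k).
Proof.
rewrite (raddf_sum (tl : {rmorphism F -> FF})); apply: eq_bigr => k _.
by rewrite -mulr_algl; exact: (rmorphM (tl : {rmorphism F -> FF})).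
Qed.

Lemma tens_free2 (c : 'I_n -> 'I_n -> K) :
  \sum_(k < n) \sum_(l < n) scal_FF (c k l) * (tl (gen_ev a b k) * tr (gen_ev a b l)) = 0 ->
  forall k l, c k l = 0.
Proof.
move=> c0 k l.
have F0 : forall l, \sum_(k < n) c k l *: gen_ev a b k = 0.
  apply: (@curve_free F (map_poly (in_alg F) (P_ev a)) (map_poly (in_alg F) (Q_ev b))).
  rewrite -[RHS]c0 sum_mul_swap; apply: eq_bigr => j _.
  by rewrite -tl_sum tr_gen tensr_f tensr_g.
apply: (@curve_free K (P_ev a) (Q_ev b) n (fun k => c k l)).
rewrite -[RHS](F0 l); apply: eq_bigr => j _.
rewrite -[c j l *: _]mulr_algl -curve_elt_gen /curve_elt eval_gen.
by [].
Qed.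

Lemma S2_tensor_inj (p q : {mpoly K[n]}) : p \is 2.-homog -> q \is 2.-homog ->
  S2_tensor a b p = S2_tensor a b q -> p = q.
Proof.
exact: (@sym_tensor_inj K n FF scal_FF (fun k => tl (gen_ev a b k))
  (fun k => tr (gen_ev a b k)) tens_free2 p q).
Qed.

Lemma scaleA_F c (h : F) : c *: h = in_alg F c * h.
Proof. by rewrite mulr_algl. Qed.

Lemma yval_l : yval scal_FF param_ev (tl f) (tl g)
  = tl g - tl (2^-1 *: horner_alg f (Q_ev b)).
Proof.
congr (_ - _); rewrite scaleA_F.
transitivity (scal_FF 2^-1 * tl (horner_alg f (Q_ev b))); last first.
  by symmetry; exact: (rmorphM (tl : {rmorphism F -> FF})).
by congr (_ * _); exact: (evalp_morph (in_alg F) (tl : {rmorphism F -> FF})).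
Qed.

Lemma yval_r : yval scal_FF param_ev (tr f) (tr g)
  = tr g - tr (2^-1 *: horner_alg f (Q_ev b)).
Proof.
congr (_ - _); rewrite scaleA_F.
transitivity (scal_FF 2^-1 * tr (horner_alg f (Q_ev b))); last first.
  transitivity (tr (in_alg F 2^-1) * tr (horner_alg f (Q_ev b))).
    by congr (_ * _); symmetry; exact: tensr_alg.
  by symmetry; exact: (rmorphM (tr : {rmorphism F -> FF})).
congr (_ * _); transitivity (evalp (tr \o in_alg F) (tr f) (Q_ev b)).
  by congr (_.[_]); apply: eq_map_poly => c; symmetry; exact: tensr_alg.
exact: (evalp_morph (in_alg F) (tr : {rmorphism F -> FF})).
Qed.

Lemma tl_vec (u : 'I_n -> K) : tl (vec_F a b u) = eval scal_FF (tl f) (tl g) (vec_pair u).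
Proof. by rewrite -curve_elt_vec; exact: tl_curve_elt. Qed.

Lemma tr_vec (u : 'I_n -> K) : tr (vec_F a b u) = eval scal_FF (tr f) (tr g) (vec_pair u).
Proof. by rewrite -curve_elt_vec; exact: tr_curve_elt. Qed.

Lemma tl_D_vec (u : 'I_n -> K) :
  tl (D_ev (vec_F a b u)) = eval scal_FF (tl f) (tl g) (der param_ev (vec_pair u)).
Proof. by rewrite -curve_elt_vec D_curve_elt; exact: tl_curve_elt. Qed.

Lemma tr_D_vec (u : 'I_n -> K) :
  tr (D_ev (vec_F a b u)) = eval scal_FF (tr f) (tr g) (der param_ev (vec_pair u)).
Proof. by rewrite -curve_elt_vec D_curve_elt; exact: tr_curve_elt. Qed.

Lemma ev_bracket_spec : is_ev_bracket a b (ev_bracket (m := m) param_ev).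
Proof.
split=> [|u v]; first exact: ev_biderivation.
rewrite ev_bracket_vec; split; first exact: qform_homog.
have [Ps Qs] := param_ev_admissible.
refine (@frac_formula FF n (tl f - tr f)
  (tl (vec_F a b u) * tr (vec_F a b v) - tl (vec_F a b v) * tr (vec_F a b u))
  (tl g + tr g - tl (2^-1 *: horner_alg f (Q_ev b)) - tr (2^-1 *: horner_alg f (Q_ev b)))
  (tl (vec_F a b u) * tr (D_ev (vec_F a b v)) + tr (vec_F a b u) * tl (D_ev (vec_F a b v))
   - tl (vec_F a b v) * tr (D_ev (vec_F a b u)) - tr (vec_F a b v) * tl (D_ev (vec_F a b u)))
  (S2_tensor a b (qform (quo param_ev (vec_pair u) (vec_pair v)))) (lambda_ev a b)
  (@lreg_f1Bf2 K a b) (@lambda_evP K a b) _).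
apply: (congr_numerator _ _ _ _ (quo_eval_mul (p := (tl f, tl g)) (q := (tr f, tr g)) m_gt0
  (erefl : param_ev.1.1 = 1) Ps Qs fg1_on fg2_on (fits_vec u) (fits_vec v))).
- rewrite S2_tensorE sym_tensor_qform; last by move=> k l; exact: quo_sym.
  apply: eq_bigr => k _; apply: eq_bigr => l _; rewrite -!curve_elt_gen.
  by congr (_ * (_ * _)); [exact: tl_curve_elt | exact: tr_curve_elt].
- transitivity ((tl g - tl (2^-1 *: horner_alg f (Q_ev b)))
      + (tr g - tr (2^-1 *: horner_alg f (Q_ev b)))); first exact: sub_swap.
  by congr (_ + _); symmetry; [exact: yval_l | exact: yval_r].
- exact: (congr2 (fun x y : FF => x - y) (congr2 *%R (tl_vec _) (tr_vec _))
    (congr2 *%R (tl_vec _) (tr_vec _))).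
apply: congr_addBB (congr2 *%R (tl_vec _) (tr_D_vec _)) (congr2 *%R (tr_vec _) (tl_D_vec _))
  (congr2 *%R (tl_vec _) (tr_D_vec _)) (congr2 *%R (tr_vec _) (tl_D_vec _)).
Qed.

(** The generators x_k are the linear forms of the unit vectors, and a biderivation
    is determined by its values on them. *)
Lemma ev_bracket_unique (B : bracket K n) : is_ev_bracket a b B ->
  forall p q, B p q = ev_bracket param_ev p q.
Proof.
move=> [bB BE]; have [bE EE] := ev_bracket_spec.
apply: biderivation_eq => // i j.
have VX k : vec_S (fun l => (k == l)%:R) = 'X_k :> {mpoly K[n]}.
  rewrite /vec_S -[RHS](sum_delta (fun k => 'X_k)); apply: eq_bigr => l _.
  by rewrite scaler_nat mulr_natr.
rewrite -(VX i) -(VX j).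
have [h1 e1] := BE (fun l => (i == l)%:R) (fun l => (j == l)%:R).
have [h2 e2] := EE (fun l => (i == l)%:R) (fun l => (j == l)%:R).
exact: (S2_tensor_inj h1 h2 (TotalFrac.tofrac_inj (etrans e1 (esym e2)))).
Qed.

End Link.

(** * The pencil of brackets *)

Section Pencil.

Variables (K : numFieldType) (m : nat).
Hypothesis m_gt0 : (0 < m)%N.

(** The unit vectors z = 1, P = f^i, Q = f^j of the space of parameters. *)
Definition basis_param (k : option ('I_5 + 'I_3)) : param K :=
  match k with
  | None => (1, 0, 0)
  | Some (inl i) => (0, 'X^i, 0)
  | Some (inr j) => (0, 0, 'X^j)
  end.

Lemma admissibleP c (t t' : param K) : admissible t -> admissible t' -> admissible (c *: t + t').
Proof.
move=> [P1 Q1] [P2 Q2]; split; apply: leq_trans (size_polyD _ _) _; rewrite geq_max.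
  by rewrite P2 andbT (leq_trans (size_scale_leq _ _)).
by rewrite Q2 andbT (leq_trans (size_scale_leq _ _)).
Qed.

Lemma basis_admissible k : admissible (basis_param k).
Proof.
by case: k => [[i|j]|]; split; rewrite /= ?size_poly0 ?size_polyXn.
Qed.

Lemma ev_bracket_compatible (t t' : param K) : admissible t -> admissible t' ->
  compatible (ev_bracket (m := m) t) (ev_bracket t').
Proof.
move=> at1 at2 u; apply: (poissonZ (c := 1) (ev_poisson m_gt0 (admissibleP u at2 at1))).
by move=> p q; rewrite scale1r ev_bracket_paramP addrC.
Qed.

Lemma param_ev_basis (a : 'I_5 -> K) (b : 'I_3 -> K) :
  param_ev a b = \sum_(j < 3) b j *: basis_param (Some (inr j))
    + (\sum_(i < 5) a i *: basis_param (Some (inl i)) + basis_param None).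
Proof.
rewrite [RHS]surjective_pairing [X in (X, _)]surjective_pairing.
rewrite !(raddfD, raddf_sum) /= /param_ev /P_ev /Q_ev.
have s0 (V : lmodType K) N (c : 'I_N -> K) : \sum_(i < N) c i *: (0 : V) = 0.
  by apply: big1 => i _; rewrite scaler0.
by rewrite !s0 !add0r !addr0.
Qed.

Lemma ev_bracket_sum (I : Type) (r : seq I) (c : I -> K) (t : I -> param K) t' p q :
  ev_bracket (m := m) (\sum_(i <- r) c i *: t i + t') p q
  = \sum_(i <- r) c i *: ev_bracket (t i) p q + ev_bracket t' p q.
Proof.
elim: r => [|i r IHr]; first by rewrite !big_nil !add0r.
by rewrite !big_cons -addrA ev_bracket_paramP IHr addrA.
Qed.

End Pencil.

Theorem proposition1 (R : realType) (n : nat)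
    (n_gt0 : (0 < n)%N) (n_even : ~~ odd n) :
  (forall (a : 'I_5 -> R[i]) (b : 'I_3 -> R[i]),
     (forall phi psi : F_ev a b,
        in_Fn n phi -> in_Fn n psi -> in_S2Fn n (formula_ev n phi psi))
     /\
     exists B : bracket R[i] n,
       [/\ is_ev_bracket a b B,
           is_poisson B,
           is_quadratic B
         & forall B' : bracket R[i] n,
             is_ev_bracket a b B' -> forall p q, B' p q = B p q])
  /\
  (exists Br : option ('I_5 + 'I_3) -> bracket R[i] n,
     [/\ forall k, is_poisson (Br k) /\ is_quadratic (Br k),
         forall k l, k != l -> compatible (Br k) (Br l)
       & forall (a : 'I_5 -> R[i]) (b : 'I_3 -> R[i]) (B : bracket R[i] n),
           is_ev_bracket a b B ->
           forall p q,
             B p q = Br None p q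
                     + \sum_(i < 5) a i *: Br (Some (inl i)) p q
                     + \sum_(j < 3) b j *: Br (Some (inr j)) p q]).
Proof.
have nE : n = n./2.*2 by rewrite -[LHS]odd_double_half (negPf n_even).
move: (n./2) nE => m nE; move: n_gt0 {n_even}; rewrite {}nE double_gt0 => m_gt0.
split=> [a b|].
  have spec := ev_bracket_spec a b m_gt0; split=> [phi psi [u ->] [v ->]|].
    have [_ /(_ u v) [p2 <-]] := spec.
    by exists (ev_bracket (param_ev a b) (vec_S u) (vec_S v)).
  exists (ev_bracket (param_ev a b)); split=> //.
  - by apply: ev_poisson => //; exact: param_ev_admissible.
  - exact: ev_quadratic.
  - by move=> B'; exact: ev_bracket_unique.
exists (fun k => ev_bracket (basis_param R[i] k)); split=> [k|k l _|a b B BE p q].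
- split; last exact: ev_quadratic.
  by apply: ev_poisson => //; exact: basis_admissible.
- by apply: ev_bracket_compatible => //; exact: basis_admissible.
rewrite (ev_bracket_unique m_gt0 BE) param_ev_basis !ev_bracket_sum.
by rewrite addrC [X in X + _]addrC.
Qed.
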